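(* For all $0<\gamma<1$ and all $\beta,\lambda\ge0$, let $G:\Delta\times\mathcal U\to\mathbb R$ be the belief-state cost function $$G(\pi,u)=(1-\gamma)\beta\tilde G_1(\pi)+\gamma\beta\tilde G_2(\pi,u)+\gamma\lambda\tilde G_3(\pi,u)+\sum_{x\in\mathcal X}\pi(x)\big[(1-\gamma)c_T(x)+\gamma c(x,u)\big]$$ and let $V:\Delta\to\mathbb R$ be the optimal value function of the associated discounted belief MDP, $$V(\pi)=\inf_{\bar\mu}E_{\bar\mu}\Big[\sum_{k=0}^\infty\gamma^kG(\pi_k,U_k)\,\Big|\,\pi_0=\pi\Big],$$ subject to $\pi_{k+1}=\Pi(\pi_k,U_k,Y_{k+1})$, $Y_{k+1}\mid\pi_k,U_k\sim p(\cdot\mid\pi_k,U_k)$, $U_k=\bar\mu(\pi_k)$, the infimum being over deterministic stationary policies $\bar\mu:\Delta\to\mathcal U$. Then $G(\cdot,u)$ is concave and continuous on $\Delta$ for every $u\in\mathcal U$, and $V$ is concave and continuous on $\Delta$.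
   Context: Logarithms are base 2 and $0\log0=0$; terms of probability zero contribute $0$. $\mathcal X=\{1,\dots,N_x\}$, $\mathcal U=\{1,\dots,N_u\}$, $\mathcal Y=\{1,\dots,N_y\}$ are finite sets of states, controls, observations; $\Delta=\{\pi\in[0,1]^{N_x}:\sum_{x\in\mathcal X}\pi(x)=1\}$ is the probability simplex. For each $u\in\mathcal U$, $A^{x,\bar x}(u)$ is the probability of moving from state $\bar x$ to state $x$ under control $u$ (so $\sum_xA^{x,\bar x}(u)=1$) and $B^{x,y}(u)$ is the probability of observing $y$ in the new state $x$ after control $u$ (so $\sum_yB^{x,y}(u)=1$). The costs $c:\mathcal X\times\mathcal U\to\mathbb R$ and $c_T:\mathcal X\to\mathbb R$ are arbitrary. Observation pmf: $p(y\mid\pi,u)=\sum_{x,\bar x\in\mathcal X}B^{x,y}(u)A^{x,\bar x}(u)\pi(\bar x)$. Bayesian filter: $$\Pi(\pi,u,y)(x)=\frac{B^{x,y}(u)\sum_{\bar x}A^{x,\bar x}(u)\pi(\bar x)}{p(y\mid\pi,u)}$$ (arbitrary element of $\Delta$ when $p(y\mid\pi,u)=0$). Belief functions: $\tilde G_1(\pi)=-\sum_x\pi(x)\log\pi(x)$; $$\tilde G_2(\pi,u)=\sum_{x,\bar x\in\mathcal X}A^{x,\bar x}(u)\pi(\bar x)\log\frac{\sum_{\underline x\in\mathcal X}A^{x,\underline x}(u)\pi(\underline x)}{A^{x,\bar x}(u)\pi(\bar x)};$$ $\tilde G_3(\pi,u)=-\sum_{y\in\mathcal Y}p(y\mid\pi,u)\log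 p(y\mid\pi,u)$. The value function $V$ satisfies Bellman's equation $V(\pi)=\min_{u\in\mathcal U}\{G(\pi,u)+\gamma\sum_{y\in\mathcal Y}p(y\mid\pi,u)V(\Pi(\pi,u,y))\}$ for all $\pi\in\Delta$. *)

(* Defs.v *)
From HB Require Import structures.
From mathcomp Require Import all_boot all_order all_algebra.
From mathcomp Require Import all_classical all_reals all_analysis.

Set Implicit Arguments.
Unset Strict Implicit.
Unset Printing Implicit Defensive.

Import Order.TTheory GRing.Theory Num.Theory.
Import numFieldNormedType.Exports.

Local Open Scope classical_set_scope.
Local Open Scope ring_scope.

(* Base-2 logarithm. As [ln 0 = 0] and [x / 0 = 0], the products
   [0 * log2 _] and [0 * log2 (_ / 0)] below are 0, as intended. *)
Definition log2 (R : realType) (x : R) : R := ln x / ln 2.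

Definition simplex (R : realType) (n : nat) : set 'rV[R]_n :=
  [set p | (forall x, 0 <= p 0 x <= 1) /\ \sum_x p 0 x = 1].
Arguments simplex : clear implicits.

Definition concave_function (R : realType) (n : nat) (D : set 'rV[R]_n)
    (f : 'rV[R]_n -> R) : Prop :=
  convex_function (D : set (convex_lmodType 'rV[R]_n)) (fun p => - f p).

(* Throughout, [A u x xb] is the probability of moving from [xb] to [x] under
   control [u], and [B u x y] that of observing [y] in the new state [x]. *)

Definition obs_pmf (R : realType) (Nx Nu Ny : nat) (A : 'I_Nu -> 'M[R]_Nx)
    (B : 'I_Nu -> 'M[R]_(Nx, Ny)) (p : 'rV[R]_Nx) (u : 'I_Nu) (y : 'I_Ny) : R :=
  \sum_x \sum_xb B u x y * A u x xb * p 0 xb.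

(* [Pi0] supplies the arbitrary value used when the observation has
   probability zero. *)
Definition bayes_filter (R : realType) (Nx Nu Ny : nat) (A : 'I_Nu -> 'M[R]_Nx)
    (B : 'I_Nu -> 'M[R]_(Nx, Ny))
    (Pi0 : 'rV[R]_Nx -> 'I_Nu -> 'I_Ny -> 'rV[R]_Nx)
    (p : 'rV[R]_Nx) (u : 'I_Nu) (y : 'I_Ny) : 'rV[R]_Nx :=
  if obs_pmf A B p u y == 0 then Pi0 p u y
  else \row_x (B u x y * (\sum_xb A u x xb * p 0 xb) / obs_pmf A B p u y).

Definition G1 (R : realType) (Nx : nat) (p : 'rV[R]_Nx) : R :=
  - \sum_x p 0 x * log2 (p 0 x).

Definition G2 (R : realType) (Nx Nu : nat) (A : 'I_Nu -> 'M[R]_Nx)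
    (p : 'rV[R]_Nx) (u : 'I_Nu) : R :=
  \sum_x \sum_xb A u x xb * p 0 xb *
    log2 ((\sum_xu A u x xu * p 0 xu) / (A u x xb * p 0 xb)).

Definition G3 (R : realType) (Nx Nu Ny : nat) (A : 'I_Nu -> 'M[R]_Nx)
    (B : 'I_Nu -> 'M[R]_(Nx, Ny)) (p : 'rV[R]_Nx) (u : 'I_Nu) : R :=
  - \sum_y obs_pmf A B p u y * log2 (obs_pmf A B p u y).

Definition belief_cost (R : realType) (Nx Nu Ny : nat)
    (A : 'I_Nu -> 'M[R]_Nx) (B : 'I_Nu -> 'M[R]_(Nx, Ny))
    (c : 'I_Nx -> 'I_Nu -> R) (cT : 'I_Nx -> R) (gamma beta lambda : R)
    (p : 'rV[R]_Nx) (u : 'I_Nu) : R :=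
  (1 - gamma) * beta * G1 p + gamma * beta * G2 A p u
  + gamma * lambda * G3 A B p u
  + \sum_x p 0 x * ((1 - gamma) * cT x + gamma * c x u).

(* The belief at time [k] under the policy [mu], started from [p] and driven by
   the observations [Y 1, Y 2, ...]; [Y 0] is not used. Policies are total
   functions on row vectors: only their values on the simplex matter, since
   beliefs started in the simplex stay in it. *)
Fixpoint belief (R : realType) (Nx Nu Ny : nat)
    (A : 'I_Nu -> 'M[R]_Nx) (B : 'I_Nu -> 'M[R]_(Nx, Ny))
    (Pi0 : 'rV[R]_Nx -> 'I_Nu -> 'I_Ny -> 'rV[R]_Nx)
    (mu : 'rV[R]_Nx -> 'I_Nu) (p : 'rV[R]_Nx) (T : Type)
    (Y : nat -> T -> 'I_Ny) (k : nat) (w : T) : 'rV[R]_Nx :=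
  if k is k'.+1 then
    let q := belief A B Pi0 mu p Y k' w in
    bayes_filter A B Pi0 q (mu q) (Y k w)
  else p.

Definition control (R : realType) (Nx Nu Ny : nat)
    (A : 'I_Nu -> 'M[R]_Nx) (B : 'I_Nu -> 'M[R]_(Nx, Ny))
    (Pi0 : 'rV[R]_Nx -> 'I_Nu -> 'I_Ny -> 'rV[R]_Nx)
    (mu : 'rV[R]_Nx -> 'I_Nu) (p : 'rV[R]_Nx) (T : Type)
    (Y : nat -> T -> 'I_Ny) (k : nat) (w : T) : 'I_Nu :=
  mu (belief A B Pi0 mu p Y k w).

(* [Y] is a sequence of discrete random variables on [(T, P)] such that the
   conditional law of [Y k.+1] given the belief and control at time [k] is
   [obs_pmf]. The belief at time [k] takes finitely many values, so that
   conditioning on it is elementary. *)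
Definition observation_process (R : realType) (Nx Nu Ny : nat)
    (A : 'I_Nu -> 'M[R]_Nx) (B : 'I_Nu -> 'M[R]_(Nx, Ny))
    (Pi0 : 'rV[R]_Nx -> 'I_Nu -> 'I_Ny -> 'rV[R]_Nx)
    (mu : 'rV[R]_Nx -> 'I_Nu) (p : 'rV[R]_Nx)
    (d : measure_display) (T : measurableType d) (P : probability T R)
    (Y : nat -> T -> 'I_Ny) : Prop :=
  (forall k y, measurable (Y k.+1 @^-1` [set y])) /\
  (forall k q u y,
    let E := [set w | belief A B Pi0 mu p Y k w = q /\
                      control A B Pi0 mu p Y k w = u] in
    (P (E `&` Y k.+1 @^-1` [set y]) = P E * (obs_pmf A B q u y)%:E)%E).

Definition discounted_cost (R : realType) (Nx Nu Ny : nat)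
    (A : 'I_Nu -> 'M[R]_Nx) (B : 'I_Nu -> 'M[R]_(Nx, Ny))
    (Pi0 : 'rV[R]_Nx -> 'I_Nu -> 'I_Ny -> 'rV[R]_Nx)
    (gamma : R) (G : 'rV[R]_Nx -> 'I_Nu -> R)
    (mu : 'rV[R]_Nx -> 'I_Nu) (p : 'rV[R]_Nx) (T : Type)
    (Y : nat -> T -> 'I_Ny) (w : T) : R :=
  limn (series (fun k => gamma ^+ k *
    G (belief A B Pi0 mu p Y k w) (control A B Pi0 mu p Y k w))).

(* The expectation does not depend on the realization [(T, P, Y)] of the
   observation process, so the infimum is over the policies [mu] alone. It is
   finite on the simplex for [0 < gamma < 1] and [G] bounded there. *)
Definition optimal_value (R : realType) (Nx Nu Ny : nat)
    (A : 'I_Nu -> 'M[R]_Nx) (B : 'I_Nu -> 'M[R]_(Nx, Ny))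
    (Pi0 : 'rV[R]_Nx -> 'I_Nu -> 'I_Ny -> 'rV[R]_Nx)
    (gamma : R) (G : 'rV[R]_Nx -> 'I_Nu -> R) (p : 'rV[R]_Nx) : R :=
  fine (ereal_inf [set v : \bar R |
    exists (mu : 'rV[R]_Nx -> 'I_Nu) (d : measure_display)
           (T : measurableType d) (P : probability T R)
           (Y : nat -> T -> 'I_Ny),
      observation_process A B Pi0 mu p P Y /\
      v = 'E_P[discounted_cost A B Pi0 gamma G mu p Y]%E]).

(* Main.v *)
Require Import Defs.
From HB Require Import structures.
From mathcomp Require Import all_boot all_order all_algebra.
From mathcomp Require Import all_classical all_reals all_analysis.
From mathcomp Require Import measurable_realfun ring lra.

Set Implicit Arguments.
Unset Strict Implicit.
Unset Printing Implicit Defensive.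

Import Order.TTheory GRing.Theory Num.Theory.
Import numFieldNormedType.Exports.

Local Open Scope classical_set_scope.
Local Open Scope ring_scope.

(** Everything is transferred from value iteration [V_n], which starts from 0.

    Costs.  The function [a * ln (s / a)] is homogeneous of degree 1 and
    superadditive by the log-sum inequality, so it is jointly concave, and each
    of the three entropies is a sum of its values at affine functions of the
    belief.  Continuity reduces to that of [x * ln x] on the whole line.

    Value iteration.  The Bellman operator preserves concavity, because
    [p(y|pi,u) * V (Pi (pi,u,y))] is the perspective of [V] composed with a
    linear map; it preserves continuity, because this product tends to 0 where
    [p(y|pi,u)] vanishes; and it is a [gamma]-contraction.

    Probability.  The expected discounted cost of a policy equals
    [sum_k gamma^k L^k g], with [L] the transition operator of the belief, for
    every realization of the observation process.  Comparing it with [V_n],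
    from below for every policy and from above for the policy greedy for [V_n],
    bounds the distance from [V_n] to the optimal value by
    [gamma^n M / (1 - gamma)], uniformly on the simplex.  That each policy has a
    realization is seen by arithmetic coding: a uniform point of [[0, 1[] is
    decoded into observations by successive subdivision. *)

(** * Concave and continuous functions on the simplex *)

(** Working form of [concave_function], with a real weight in place of one of interval type;
    [concave_onW] converts. *)
Definition concave_on (R : realType) (n : nat) (D : set 'rV[R]_n)
    (f : 'rV[R]_n -> R) : Prop :=
  forall t p q, 0 <= t <= 1 -> D p -> D q ->
    t * f p + (1 - t) * f q <= f (t *: p + (1 - t) *: q).

Definition continuous_on (R : realType) (n : nat) (D : set 'rV[R]_n)
    (f : 'rV[R]_n -> R) : Prop :=
  forall p, D p -> f @ within D (nbhs p) --> f p.

Lemma concave_onW (R : realType) (n : nat) (D : set 'rV[R]_n)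
    (f : 'rV[R]_n -> R) : concave_on D f -> concave_function D f.
Proof.
move=> cf t p q /set_mem Dp /set_mem Dq.
have t01 : 0 <= t%:inum <= 1 by apply/andP; split.
apply: le_trans (_ : - (t%:inum * f p + (1 - t%:inum) * f q) <= _).
  by rewrite lerN2; exact: cf.
by rewrite opprD -!mulrN.
Qed.

(** For [x > 0] and [s = sqrt x], [x * ln x = - 2 * s^2 * ln s^-1], and [ln s^-1 <= s^-1] leaves
    [2 * s]. For [x <= 0] the logarithm is 0 by convention. *)
Lemma xlnx_le_sqrt (R : realType) (x : R) : x <= 1 ->
  `|x * ln x| <= 2 * Num.sqrt x.
Proof.
move=> x1; have [x0|x0] := leP x 0.
  by rewrite ln0// mulr0 normr0 mulr_ge0// sqrtr_ge0.
set s := Num.sqrt x.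
have s0 : 0 < s by rewrite sqrtr_gt0.
have xs : x = s * s by rewrite -expr2 sqr_sqrtr// ltW.
have lnx : ln x = - (2 * ln s^-1).
  by rewrite xs lnM ?posrE// lnV ?posrE//; ring.
rewrite ler0_norm; last by apply: mulr_ge0_le0; [exact: ltW|exact: ln_le0].
rewrite lnx mulrN opprK mulrCA ler_pM2l//.
have h : ln s^-1 <= s^-1 by rewrite ltW// ln_sublinear// invr_gt0.
rewrite xs -mulrA -[leRHS]mulr1 ler_pM2l//.
by rewrite -ler_pdivlMl// mulr1.
Qed.

(** As [ln] is 0 on nonpositive numbers, the function is locally 0 at negative points; at 0 it is
    squeezed by the square root bound. *)
Lemma continuous_xlnx (R : realType) : continuous (fun x : R => x * ln x).
Proof.
move=> x; have [x0|x0|->] := ltgtP x 0.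
- have fx : x * ln x = 0 by rewrite ln0 ?mulr0// ltW.
  suff : (fun y : R => y * ln y) @ x --> (0 : R) by rewrite -fx.
  have c0 : (fun=> 0 : R) @ x --> (0 : R) by exact: cvg_cst.
  apply: cvg_trans c0; apply: near_eq_cvg; near=> y.
  rewrite ln0 ?mulr0// ltW//.
  by near: y; exact: lt_nbhsl.
- by apply: cvgM; [exact: cvg_id|exact: continuous_ln].
- suff : (fun y : R => y * ln y) @ (0 : R) --> (0 : R).
    by rewrite -[X in _ --> X](mul0r (ln 0)).
  apply/norm_cvg0P.
  apply: (@squeeze_cvgr _ _ _ _ (fun=> 0) (fun y : R => 2 * Num.sqrt y)).
  + near=> y; rewrite normr_ge0/= xlnx_le_sqrt// ltW//.
    by near: y; exact: lt_nbhsl.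
  + exact: cvg_cst.
  + have : (fun y : R => 2 * Num.sqrt y) @ (0 : R) --> 2 * Num.sqrt (0 : R).
      by apply: cvgM; [exact: cvg_cst|exact: sqrt_continuous].
    by rewrite sqrtr0 mulr0.
Unshelve. all: by end_near. Qed.

(* The function [a * ln (s / a)] is homogeneous of degree 1 and superadditive
   (log-sum inequality); all three entropies are sums of its values. *)
Lemma ln_sum_ineq (R : realType) (a1 s1 a2 s2 : R) :
  0 <= a1 <= s1 -> 0 <= a2 <= s2 ->
  a1 * ln (s1 / a1) + a2 * ln (s2 / a2) <=
  (a1 + a2) * ln ((s1 + s2) / (a1 + a2)).
Proof.
move=> /andP[a10 as1] /andP[a20 as2].
have [sum0|sum0] := eqVneq (a1 + a2) 0.
  have a1E : a1 = 0 by lra.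
  have a2E : a2 = 0 by lra.
  by rewrite a1E a2E !mul0r !addr0 mul0r.
have apos : 0 < a1 + a2 by rewrite lt0r sum0 addr_ge0.
have spos : 0 < s1 + s2 by lra.
set r := (s1 + s2) / (a1 + a2).
have rpos : 0 < r by rewrite divr_gt0.
(* This is [ln z <= z - 1] at [z = s / a / r]. Summed over both pairs, the errors cancel because
   [s1 / r + s2 / r = a1 + a2]. *)
have key a s : 0 <= a -> a <= s -> a * ln (s / a) <= a * ln r + (s / r - a).
  move=> a0 as_; have [->|an0] := eqVneq a 0.
    rewrite !mul0r subr0 add0r divr_ge0//; last exact: ltW.
    exact: le_trans as_.
  have ap : 0 < a by rewrite lt0r an0.
  have sp : 0 < s by lra.
  have -> : s / a = r * (s / a / r) by field; rewrite an0 gt_eqF.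
  rewrite lnM ?posrE ?divr_gt0// mulrDr lerD2l.
  have -> : s / r - a = a * (s / a / r - 1) by field; rewrite an0 gt_eqF.
  rewrite ler_pM2l//.
  have -> : s / a / r = 1 + (s / a / r - 1) by ring.
  apply: le_trans (le_ln1Dx _) _; last by lra.
  by rewrite ltrBrDl subrr divr_gt0 ?divr_gt0.
apply: (le_trans (lerD (key _ _ a10 as1) (key _ _ a20 as2))).
rewrite addrACA -mulrDl gerDl.
have : s1 / r + s2 / r = a1 + a2.
  by rewrite -mulrDl /r; field; rewrite sum0 gt_eqF.
by lra.
Qed.

(** Homogeneity moves the weights [t] and [1 - t] into the arguments, and superadditivity
    applies. *)
Lemma ln_sum_ineq_conv (R : realType) (t a1 s1 a2 s2 : R) :
  0 <= t <= 1 -> 0 <= a1 <= s1 -> 0 <= a2 <= s2 ->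
  t * (a1 * ln (s1 / a1)) + (1 - t) * (a2 * ln (s2 / a2)) <=
  (t * a1 + (1 - t) * a2) *
    ln ((t * s1 + (1 - t) * s2) / (t * a1 + (1 - t) * a2)).
Proof.
move=> /andP[t0 t1] /andP[a10 as1] /andP[a20 as2].
have t1' : 0 <= 1 - t by lra.
have hom (c a s : R) : c * (a * ln (s / a)) = (c * a) * ln ((c * s) / (c * a)).
  have [->|c0] := eqVneq c 0; first by rewrite !mul0r.
  by rewrite -mulf_div divff// mul1r mulrA.
rewrite (hom t) (hom (1 - t)).
by apply: ln_sum_ineq; rewrite mulr_ge0//= ler_wpM2l.
Qed.

(** * Stability of concavity and continuity on a set under sums, scaling and uniform limits *)

Section continuity.
Variables (R : realType) (n : nat).
Implicit Types (D : set 'rV[R]_n) (f g : 'rV[R]_n -> R) (p q : 'rV[R]_n).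

Lemma continuous_onW D f : continuous f -> continuous_on D f.
Proof. by move=> cf p _; exact: cvg_within_filter (cf p). Qed.

Lemma continuous_on_ext D f g : (forall p, D p -> f p = g p) ->
  continuous_on D f -> continuous_on D g.
Proof.
move=> fg cf p Dp; rewrite -(fg p Dp).
apply: cvg_trans (cf p Dp); apply: near_eq_cvg.
by rewrite near_withinE; near=> q => Dq; exact: fg.
Unshelve. all: by end_near. Qed.

Lemma concave_on_ext D f g :
  (forall t p q, 0 <= t <= 1 -> D p -> D q -> D (t *: p + (1 - t) *: q)) ->
  (forall p, D p -> f p = g p) -> concave_on D f -> concave_on D g.
Proof.
by move=> cD fg cf t p q t01 Dp Dq; rewrite -!fg//; [exact: cf|exact: cD].
Qed.

Lemma concave_onD D f g : concave_on D f -> concave_on D g ->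
  concave_on D (fun p => f p + g p).
Proof.
by move=> cf cg t p q t01 Dp Dq; rewrite !mulrDr addrACA lerD ?cf ?cg.
Qed.

Lemma concave_onZ D (k : R) f : 0 <= k -> concave_on D f ->
  concave_on D (fun p => k * f p).
Proof.
move=> k0 cf t p q t01 Dp Dq.
by rewrite !(mulrCA _ k) -mulrDr ler_wpM2l// cf.
Qed.

Lemma concave_on_sum D (I : Type) (r : seq I) (F : I -> 'rV[R]_n -> R) :
  (forall i, concave_on D (F i)) -> concave_on D (fun p => \sum_(i <- r) F i p).
Proof.
move=> cF t p q t01 Dp Dq; rewrite !mulr_sumr -big_split/=.
by apply: ler_sum => i _; exact: cF.
Qed.

Lemma continuous_on_within D f : continuous_on D f <->
  {within D, continuous f}.
Proof.
by split => [cf|/subspace_continuousP//]; exact/subspace_continuousP.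
Qed.

Lemma continuous_onD D f g : continuous_on D f -> continuous_on D g ->
  continuous_on D (fun p => f p + g p).
Proof. by move=> cf cg p Dp; apply: cvgD; [exact: cf|exact: cg]. Qed.

Lemma continuous_onZ D (k : R) f : continuous_on D f ->
  continuous_on D (fun p => k * f p).
Proof. by move=> cf p Dp; apply: cvgM; [exact: cvg_cst|exact: cf]. Qed.

Lemma continuous_on_sum D (I : Type) (r : seq I) (F : I -> 'rV[R]_n -> R) :
  (forall i, continuous_on D (F i)) ->
  continuous_on D (fun p => \sum_(i <- r) F i p).
Proof.
move=> cF p Dp; apply: cvg_big; first exact: add_continuous.
by move=> i _; exact: cF.
Qed.

Lemma continuous_onP D f : continuous_on D f <->
  forall p, D p -> forall e : R, 0 < e ->
    \forall q \near nbhs p, D q -> `|f p - f q| < e.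
Proof.
split=> cf p Dp.
  move=> e e0; have /cvgrPdist_lt /(_ _ e0) := cf p Dp.
  by rewrite near_withinE.
apply/cvgrPdist_lt => e e0; rewrite near_withinE; exact: cf.
Qed.

Lemma uniform_limit_continuous_on D f :
  (forall e : R, 0 < e -> exists2 g, continuous_on D g &
     forall p, D p -> `|f p - g p| <= e) ->
  continuous_on D f.
Proof.
move=> H; apply/continuous_onP => p Dp e e0.
have e4 : 0 < e / 4 by rewrite divr_gt0.
have [g /continuous_onP cg fg] := H _ e4.
apply: filterS (cg p Dp _ e4) => q /[swap] Dq /(_ Dq).
have := fg _ Dp; have := fg _ Dq.
rewrite !ltr_norml !ler_norml => /andP[? ?] /andP[? ?] /andP[? ?].
by apply/andP; split; lra.
Qed.

Lemma uniform_limit_concave_on D f :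
  (forall t p q, 0 <= t <= 1 -> D p -> D q -> D (t *: p + (1 - t) *: q)) ->
  (forall e : R, 0 < e -> exists2 g, concave_on D g &
     forall p, D p -> `|f p - g p| <= e) ->
  concave_on D f.
Proof.
move=> cD H t p q t01 Dp Dq; apply/ler_addgt0Pr => e e0.
have e2 : 0 < e / 2 by rewrite divr_gt0.
have [g cg fg] := H _ e2.
have := fg _ (cD _ _ _ t01 Dp Dq); have := fg _ Dp; have := fg _ Dq.
have := cg _ _ _ t01 Dp Dq.
case/andP: t01 => t0 t1 cgpq; rewrite !ler_norml.
move=> /andP[_ fq] /andP[_ fp] /andP[fpq _].
have h1 : t * f p <= t * (g p + e / 2) by rewrite ler_wpM2l//; lra.
have h2 : (1 - t) * f q <= (1 - t) * (g q + e / 2).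
  by rewrite ler_wpM2l//; lra.
by rewrite mulrDr in h1; rewrite mulrDr in h2; lra.
Qed.

End continuity.

Section simplex_lemmas.
Variables (R : realType) (n : nat).
Local Notation D := (simplex R n).

Lemma simplex_conv t (p q : 'rV[R]_n) : 0 <= t <= 1 -> D p -> D q ->
  D (t *: p + (1 - t) *: q).
Proof.
move=> /andP[t0 t1] [p0 p1] [q0 q1]; split.
  move=> x; rewrite !mxE; have := p0 x; have := q0 x.
  by move=> /andP[? ?] /andP[? ?]; apply/andP; split; nra.
under eq_bigr do rewrite !mxE.
by rewrite big_split/= -!mulr_sumr p1 q1; ring.
Qed.

Lemma simplexP (p : 'rV[R]_n) : (forall x, 0 <= p 0 x) -> \sum_x p 0 x = 1 ->
  D p.
Proof.
move=> p0 p1; split=> // x; rewrite p0/= -p1 (bigD1 x)//= lerDl.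
by rewrite sumr_ge0.
Qed.

(** The simplex lies in the cube [[0, 1]^n], a compact product of segments, whose image under [f] is
    bounded; hence continuity is asked on the whole space. *)
Lemma simplex_bounded (f : 'rV[R]_n -> R) : continuous f ->
  exists2 M, 0 <= M & forall p, D p -> `|f p| <= M.
Proof.
move=> cf.
have cK := @rV_compact R n (fun=> `[0, 1]%classic)
  (fun=> @segment_compact R 0 1).
have /compact_bounded [M [_ HM]] :=
  continuous_compact (continuous_subspaceT cf) cK.
exists (`|M| + 1); first by rewrite addr_ge0.
move=> p [Dp _]; apply: (HM (`|M| + 1)); first by rewrite ltr_pwDr// ler_norm.
by exists p => // i /=; rewrite in_itv/= Dp.
Qed.

End simplex_lemmas.

(** * The belief cost *)

Definition affine_fun (R : realType) (n : nat) (f : 'rV[R]_n -> R) : Prop :=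
  forall t p q, f (t *: p + (1 - t) *: q) = t * f p + (1 - t) * f q.

Section affine.
Variables (R : realType) (n : nat).

Lemma affine_sum (I : Type) (r : seq I) (F : I -> 'rV[R]_n -> R) :
  (forall i, affine_fun (F i)) -> affine_fun (fun p => \sum_(i <- r) F i p).
Proof.
move=> aF t p q; rewrite !mulr_sumr -big_split/=.
by apply: eq_bigr => i _; exact: aF.
Qed.

Lemma affine_coord (a : R) i : affine_fun (fun p : 'rV[R]_n => a * p 0 i).
Proof. by move=> t p q; rewrite !mxE; ring. Qed.

Lemma concave_on_affine D (f : 'rV[R]_n -> R) : affine_fun f -> concave_on D f.
Proof. by move=> af t p q _ _ _; rewrite af. Qed.

(** The pattern of all three entropies: [s] is the constant 1 for [G1] and [G3], and the predicted
    probability of the new state for [G2]. *)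
Lemma concave_on_ln_ratio D (a s : 'rV[R]_n -> R) :
  affine_fun a -> affine_fun s -> (forall p, D p -> 0 <= a p <= s p) ->
  concave_on D (fun p => a p * ln (s p / a p)).
Proof.
by move=> aa as_ h t p q t01 Dp Dq; rewrite aa as_ ln_sum_ineq_conv// h.
Qed.

Lemma continuous_comp_xlnx (f : 'rV[R]_n -> R) :
  continuous f -> continuous (fun p => f p * ln (f p)).
Proof.
move=> cf p.
exact: (@continuous_comp _ _ _ f (fun x => x * ln x) p (cf p)
  (@continuous_xlnx R _)).
Qed.

Lemma continuous_coordZ (a : R) i : continuous (fun p : 'rV[R]_n => a * p 0 i).
Proof.
by move=> p; apply: (@cvgMl_tmp _ _ (nbhs p)); exact: coord_continuous.
Qed.

Lemma continuous_sumr (I : Type) (r : seq I) (F : I -> 'rV[R]_n -> R) :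
  (forall i, continuous (F i)) -> continuous (fun p => \sum_(i <- r) F i p).
Proof.
move=> cF; apply: continuous_big => [|i _]; first exact: add_continuous.
exact: cF.
Qed.

Lemma continuous_scaler (k : R) (f : 'rV[R]_n -> R) : continuous f ->
  continuous (fun p => k * f p).
Proof. by move=> cf p; apply: (@cvgMl_tmp _ _ (nbhs p)); exact: cf. Qed.

Lemma continuous_addr (f g : 'rV[R]_n -> R) : continuous f -> continuous g ->
  continuous (fun p => f p + g p).
Proof. by move=> cf cg p; exact: (cvgD (cf p) (cg p)). Qed.

End affine.

Lemma ln2_gt0 (R : realType) : 0 < ln 2 :> R.
Proof. by rewrite ln_gt0// ltr1n. Qed.

Lemma mul_log2 (R : realType) (x y : R) : x * log2 y = (ln 2)^-1 * (x * ln y).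
Proof. by rewrite /log2; ring. Qed.

Lemma ln_inv_xlnx (R : realType) (x : R) : 0 <= x ->
  - (x * ln x) = x * ln (1 / x).
Proof.
rewrite le_eqVlt => /predU1P[<-|x0]; first by rewrite !mul0r oppr0.
by rewrite div1r lnV ?posrE// mulrN.
Qed.

Section cost.
Variables (R : realType) (Nx Nu Ny : nat).
Variables (A : 'I_Nu -> 'M[R]_Nx) (B : 'I_Nu -> 'M[R]_(Nx, Ny)).
Hypothesis hA0 : forall u x xb, 0 <= A u x xb.
Hypothesis hA1 : forall u xb, \sum_x A u x xb = 1.
Hypothesis hB0 : forall u x y, 0 <= B u x y.
Hypothesis hB1 : forall u x, \sum_y B u x y = 1.
Implicit Types (p q : 'rV[R]_Nx) (u : 'I_Nu) (y : 'I_Ny).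
Local Notation D := (simplex R Nx).
Local Notation obs := (obs_pmf A B).

Lemma obs_pmf_affine u y : affine_fun (fun p => obs p u y).
Proof. by do 2 apply: affine_sum => ?; exact: affine_coord. Qed.

Lemma obs_pmf_continuous u y : continuous (fun p => obs p u y).
Proof. by do 2 apply: continuous_sumr => ?; exact: continuous_coordZ. Qed.

Lemma predict_ge0 p u x : D p -> 0 <= \sum_xb A u x xb * p 0 xb.
Proof.
move=> [p0 _]; apply: sumr_ge0 => xb _; rewrite mulr_ge0//.
by have /andP[] := p0 xb.
Qed.

Lemma obs_pmfE p u y :
  obs p u y = \sum_x B u x y * \sum_xb A u x xb * p 0 xb.
Proof.
apply: eq_bigr => x _; rewrite mulr_sumr.
by apply: eq_bigr => xb _; rewrite mulrA.
Qed.

Lemma obs_pmf_ge0 p u y : D p -> 0 <= obs p u y.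
Proof.
move=> Dp; rewrite obs_pmfE; apply: sumr_ge0 => x _.
by rewrite mulr_ge0// predict_ge0.
Qed.

Lemma predict_sum p u : D p -> \sum_x \sum_xb A u x xb * p 0 xb = 1.
Proof.
move=> [_ p1]; rewrite exchange_big/= -[RHS]p1; apply: eq_bigr => xb _.
by rewrite -mulr_suml hA1 mul1r.
Qed.

Lemma obs_pmf_sum p u : D p -> \sum_y obs p u y = 1.
Proof.
move=> Dp; under eq_bigr do rewrite obs_pmfE.
rewrite exchange_big/= -[RHS](predict_sum u Dp); apply: eq_bigr => x _.
by rewrite -mulr_suml hB1 mul1r.
Qed.

Lemma obs_pmf_le1 p u y : D p -> obs p u y <= 1.
Proof.
move=> Dp; rewrite -(obs_pmf_sum u Dp) (bigD1 y)//= lerDl.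
by apply: sumr_ge0 => *; exact: obs_pmf_ge0.
Qed.

Lemma G1_concave : concave_on D (@G1 R Nx).
Proof.
(* The factors [1 *] give the coordinates the shape of [affine_coord]. *)
apply: (@concave_on_ext _ _ _
  (fun p => (ln 2)^-1 * \sum_x (1 * p 0 x) * ln (1 / (1 * p 0 x)))).
- exact: simplex_conv.
- move=> p [p0 _]; rewrite /G1 -sumrN mulr_sumr; apply: eq_bigr => x _.
  rewrite mul1r mul_log2 -mulrN ln_inv_xlnx//.
  by have /andP[] := p0 x.
apply: concave_onZ; first by rewrite invr_ge0 ltW// ln2_gt0.
apply: concave_on_sum => x.
apply: (@concave_on_ln_ratio _ _ _ (fun p => 1 * p 0 x) (fun=> 1)).
- exact: affine_coord.
- by move=> *; ring.
- by move=> p [p0 _]; rewrite mul1r.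
Qed.

Lemma G3_concave u : concave_on D (fun p => G3 A B p u).
Proof.
apply: (@concave_on_ext _ _ _
  (fun p => (ln 2)^-1 * \sum_y obs p u y * ln (1 / obs p u y))).
- exact: simplex_conv.
- move=> p Dp; rewrite /G3 -sumrN mulr_sumr; apply: eq_bigr => y _.
  by rewrite mul_log2 -mulrN ln_inv_xlnx// obs_pmf_ge0.
apply: concave_onZ; first by rewrite invr_ge0 ltW// ln2_gt0.
apply: concave_on_sum => y.
apply: (@concave_on_ln_ratio _ _ _ (fun p => obs p u y) (fun=> 1)).
- exact: obs_pmf_affine.
- by move=> *; ring.
- by move=> p Dp; rewrite obs_pmf_ge0// obs_pmf_le1.
Qed.

Lemma transition_le_predict p u x xb : D p ->
  0 <= A u x xb * p 0 xb <= \sum_xu A u x xu * p 0 xu.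
Proof.
move=> [p0 _]; have h xu : 0 <= A u x xu * p 0 xu.
  by rewrite mulr_ge0//; have /andP[] := p0 xu.
by rewrite h/= (bigD1 xb)//= lerDl sumr_ge0.
Qed.

Lemma G2_concave u : concave_on D (fun p => G2 A p u).
Proof.
apply: concave_on_sum => x; apply: concave_on_sum => xb.
under [X in concave_on _ X]funext do rewrite mul_log2.
apply: concave_onZ; first by rewrite invr_ge0 ltW// ln2_gt0.
apply: (@concave_on_ln_ratio _ _ _ (fun p => A u x xb * p 0 xb)
  (fun p => \sum_xu A u x xu * p 0 xu)).
- exact: affine_coord.
- by apply: affine_sum => ?; exact: affine_coord.
- by move=> p Dp; exact: transition_le_predict.
Qed.

(** Splitting the logarithm of the quotient leaves only terms [x * ln x], whose continuity is known.
    Where the joint probability is 0, both sides vanish. *)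
Lemma G2E p u : D p -> G2 A p u =
  (ln 2)^-1 * \sum_x ((\sum_xb A u x xb * p 0 xb) *
      ln (\sum_xb A u x xb * p 0 xb) +
    -1 * \sum_xb (A u x xb * p 0 xb) * ln (A u x xb * p 0 xb)).
Proof.
move=> Dp; rewrite /G2 mulr_sumr; apply: eq_bigr => x _.
rewrite mulr_suml mulr_sumr -big_split/= mulr_sumr; apply: eq_bigr => xb _.
rewrite mul_log2; congr *%R; rewrite mulN1r.
have /andP[] := transition_le_predict u x xb Dp.
rewrite le_eqVlt => /predU1P[<-|a0 aS]; first by rewrite !mul0r subr0.
by rewrite ln_div ?posrE// ?mulrBr// (lt_le_trans a0).
Qed.

Variables (c : 'I_Nx -> 'I_Nu -> R) (cT : 'I_Nx -> R) (gamma beta lambda : R).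
Hypothesis hgamma : 0 < gamma < 1.
Hypothesis hbeta : 0 <= beta.
Hypothesis hlambda : 0 <= lambda.
Local Notation G := (belief_cost A B c cT gamma beta lambda).

Lemma belief_cost_concave u : concave_on D (fun p => G p u).
Proof.
have /andP[g0 g1] := hgamma.
apply: concave_onD; last first.
  apply: concave_on_affine; apply: affine_sum => x t p q.
  by rewrite !mxE; ring.
apply: concave_onD; last first.
  by apply: concave_onZ; [rewrite mulr_ge0// ltW|exact: G3_concave].
apply: concave_onD.
  apply: concave_onZ; last exact: G1_concave.
  by rewrite mulr_ge0// subr_ge0 ltW.
by apply: concave_onZ; [rewrite mulr_ge0// ltW|exact: G2_concave].
Qed.

(* On the simplex the cost is the restriction of a function which is continuous
   everywhere, because [x * ln x] is continuous on the whole line. *)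
Lemma belief_cost_continuous u :
  exists2 g, continuous g & forall p, D p -> g p = G p u.
Proof.
pose g2 p := (ln 2)^-1 * \sum_x ((\sum_xb A u x xb * p 0 xb) *
      ln (\sum_xb A u x xb * p 0 xb) +
    -1 * \sum_xb (A u x xb * p 0 xb) * ln (A u x xb * p 0 xb)).
pose g1 (p : 'rV[R]_Nx) :=
  -1 * \sum_x (ln 2)^-1 * ((1 * p 0 x) * ln (1 * p 0 x)).
pose g3 p := -1 * \sum_y (ln 2)^-1 * (obs p u y * ln (obs p u y)).
exists (fun p => (1 - gamma) * beta * g1 p + gamma * beta * g2 p
  + gamma * lambda * g3 p
  + \sum_x ((1 - gamma) * cT x + gamma * c x u) * p 0 x).
  apply: continuous_addr; last first.
    by apply: continuous_sumr => x; exact: continuous_coordZ.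
  apply: continuous_addr; last first.
    do 2 apply: continuous_scaler; apply: continuous_sumr => y.
    apply: continuous_scaler; apply: continuous_comp_xlnx.
    exact: obs_pmf_continuous.
  apply: continuous_addr.
    do 2 apply: continuous_scaler; apply: continuous_sumr => x.
    apply: continuous_scaler; apply: continuous_comp_xlnx.
    exact: continuous_coordZ.
  do 2 apply: continuous_scaler; apply: continuous_sumr => x.
  apply: continuous_addr.
    apply: continuous_comp_xlnx.
    by apply: continuous_sumr => ?; exact: continuous_coordZ.
  apply: continuous_scaler; apply: continuous_sumr => xb.
  by apply: continuous_comp_xlnx; exact: continuous_coordZ.
move=> p Dp; rewrite /belief_cost G2E//; congr (_ + _ + _ + _).
- congr *%R; rewrite /g1 /G1 mulN1r; congr -%R.
  by apply: eq_bigr => x _; rewrite mul_log2 mul1r.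
- congr *%R; rewrite /g3 /G3 mulN1r; congr -%R.
  by apply: eq_bigr => y _; rewrite mul_log2.
- by apply: eq_bigr => x _; rewrite mulrC.
Qed.

Lemma belief_cost_continuous_on u : continuous_on D (fun p => G p u).
Proof.
have [g cg gG] := belief_cost_continuous u.
exact: continuous_on_ext gG (continuous_onW cg).
Qed.

Lemma belief_cost_bounded :
  exists2 M, 0 <= M & forall p u, D p -> `|G p u| <= M.
Proof.
have bnd u : exists M, 0 <= M /\ forall p, D p -> `|G p u| <= M.
  have [g /simplex_bounded[M M0 gM] gG] := belief_cost_continuous u.
  by exists M; split=> // p Dp; rewrite -gG// gM.
have [M HM] := choice bnd.
exists (\sum_u M u); first by apply: sumr_ge0 => u _; case: (HM u).
move=> p u Dp; rewrite (bigD1 u)//=.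
apply: ler_wpDr; last by case: (HM u) => _; exact.
by apply: sumr_ge0 => v _; case: (HM v).
Qed.

End cost.

(** * Value iteration *)

Lemma cvg_rV (R : realType) (n : nat) (T : Type) (F : set_system T)
    (FF : Filter F) (f : T -> 'rV[R]_n) (v : 'rV[R]_n) :
  (forall i, f x 0 i @[x --> F] --> v 0 i) -> f @ F --> v.
Proof.
move=> H U [P Pv PU].
have h : \forall x \near F, forall i j, P i j (f x i j).
  apply: filter_forall => i; apply: filter_forall => j.
  by have := H j (P i j); rewrite (ord1 i); apply; exact: Pv.
by apply: filterS h => x Px; exact: PU.
Qed.

Section bellman.
Variables (R : realType) (Nx Nu Ny : nat).
Variables (A : 'I_Nu -> 'M[R]_Nx) (B : 'I_Nu -> 'M[R]_(Nx, Ny)).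
Hypothesis hA0 : forall u x xb, 0 <= A u x xb.
Hypothesis hA1 : forall u xb, \sum_x A u x xb = 1.
Hypothesis hB0 : forall u x y, 0 <= B u x y.
Hypothesis hB1 : forall u x, \sum_y B u x y = 1.
Variable Pi0 : 'rV[R]_Nx -> 'I_Nu -> 'I_Ny -> 'rV[R]_Nx.
Local Notation D := (simplex R Nx).
Hypothesis hPi0 : forall p u y, D p -> D (Pi0 p u y).
Implicit Types (p q : 'rV[R]_Nx) (u : 'I_Nu) (y : 'I_Ny) (h k : 'rV[R]_Nx -> R).
Local Notation obs := (obs_pmf A B).
Local Notation bayes := (bayes_filter A B Pi0).

(** Bayes' rule cleared of its denominator, so that it covers observations of probability zero too:
    there the right-hand side is a term of a vanishing sum of nonnegative terms. *)
Lemma obs_mul_bayes p u y x : D p ->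
  obs p u y * bayes p u y 0 x = B u x y * \sum_xb A u x xb * p 0 xb.
Proof.
move=> Dp; have ge0 (i : 'I_Nx) : 0 <= B u i y * \sum_xb A u i xb * p 0 xb.
  by rewrite mulr_ge0// predict_ge0.
rewrite /bayes_filter; case: eqVneq => [zo|zo].
  rewrite zo mul0r; apply/esym/eqP; rewrite eq_le ge0 andbT.
  apply: (@le_trans _ _ (obs p u y)); last by rewrite zo.
  by rewrite obs_pmfE [leRHS](bigD1 x)//= lerDl sumr_ge0.
by rewrite mxE mulrC divfK.
Qed.

Lemma bayes_filter_simplex p u y : D p -> D (bayes p u y).
Proof.
move=> Dp; have [zo|zo] := eqVneq (obs p u y) 0.
  by rewrite /bayes_filter zo eqxx; exact: hPi0.
have op : 0 < obs p u y by rewrite lt0r zo obs_pmf_ge0.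
apply: simplexP => [x|].
  by rewrite -(pmulr_rge0 _ op) obs_mul_bayes// mulr_ge0// predict_ge0.
apply: (mulfI zo); rewrite mulr1 mulr_sumr obs_pmfE.
by apply: eq_bigr => x _; rewrite -obs_pmfE obs_mul_bayes.
Qed.

(* The perspective of a concave function is concave: the posterior of a mixture
   of beliefs is a mixture of the posteriors, with weights proportional to the
   observation probabilities. *)
Lemma obs_mul_comp_concave h u y : concave_on D h ->
  concave_on D (fun p => obs p u y * h (bayes p u y)).
Proof.
move=> ch t p q t01 Dp Dq /=.
have Dr := simplex_conv t01 Dp Dq; set r := t *: p + (1 - t) *: q in Dr *.
have orE : obs r u y = t * obs p u y + (1 - t) * obs q u y.
  exact: obs_pmf_affine.
have /andP[t0 t1] := t01.
have tp : 0 <= t * obs p u y by rewrite mulr_ge0// obs_pmf_ge0.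
have tq : 0 <= (1 - t) * obs q u y by rewrite mulr_ge0 ?subr_ge0// obs_pmf_ge0.
(* If the mixture gives [y] probability zero, both nonnegative summands of that probability are
   zero. *)
rewrite !mulrA; have [zo|zo] := eqVneq (obs r u y) 0.
  have -> : t * obs p u y = 0 by lra.
  have -> : (1 - t) * obs q u y = 0 by lra.
  by rewrite zo !mul0r addr0.
have op : 0 < obs r u y by rewrite lt0r zo obs_pmf_ge0.
pose s := t * obs p u y / obs r u y.
have s1 : 1 - s = (1 - t) * obs q u y / obs r u y.
  by rewrite /s; apply: (mulIf zo); rewrite mulrBl !divfK// mul1r orE; ring.
have s01 : 0 <= s <= 1.
  by rewrite divr_ge0 ?(ltW op)//= -subr_ge0 s1 divr_ge0// ltW.
have divE (a b : R) : obs r u y * (a / obs r u y * b) = a * b.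
  by rewrite mulrA [obs r u y * _]mulrC divfK.
(* Multiplied by [obs r u y], this is the linearity of the unnormalized posterior. *)
have bE : bayes r u y = s *: bayes p u y + (1 - s) *: bayes q u y.
  apply/rowP => x; apply: (mulfI zo); rewrite obs_mul_bayes// !mxE s1 mulrDr.
  rewrite /s !divE -!mulrA !obs_mul_bayes// !mulr_sumr -big_split/=.
  by apply: eq_bigr => xb _; rewrite !mxE; ring.
have := ch _ _ _ s01 (bayes_filter_simplex u y Dp)
  (bayes_filter_simplex u y Dq).
by rewrite -bE -(ler_pM2l op) mulrDr s1 /s !divE.
Qed.

Lemma bayes_filter_continuous p u y : obs p u y != 0 ->
  (fun q => bayes q u y) @ p --> bayes p u y.
Proof.
move=> zo; apply: (@cvg_rV _ _ _ (nbhs p)) => x.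
(* Near [p] the filter is therefore given by its quotient formula, away from the values of [Pi0]. *)
have no0 : \forall q \near p, obs q u y != 0.
  apply: (@cvgr_neq0 _ _ _ (nbhs p) _ _ (obs p u y)) => //.
  exact: obs_pmf_continuous.
have bE q : obs q u y != 0 -> bayes q u y 0 x =
    B u x y * (\sum_xb A u x xb * q 0 xb) / obs q u y.
  by rewrite /bayes_filter => /negPf ->; rewrite mxE.
rewrite bE//.
have lim : (fun q => B u x y * (\sum_xb A u x xb * q 0 xb) / obs q u y) @ p -->
    B u x y * (\sum_xb A u x xb * p 0 xb) / obs p u y.
  have c1 : continuous (fun q => B u x y * (\sum_xb A u x xb * q 0 xb)).
    by apply: continuous_scaler; apply: continuous_sumr => ?;
      exact: continuous_coordZ.
  exact: (cvgM (c1 p) (cvgV zo (@obs_pmf_continuous _ _ _ _ A B u y p))).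
apply: cvg_trans lim; apply: near_eq_cvg.
by apply: filterS no0 => q /bE ->.
Qed.

Lemma obs_mul_comp_continuous h u y (K : R) : (forall p, D p -> `|h p| <= K) ->
  continuous_on D h ->
  continuous_on D (fun p => obs p u y * h (bayes p u y)).
Proof.
move=> hK ch p Dp.
have co := @obs_pmf_continuous _ _ _ _ A B u y p.
have [zo|zo] := eqVneq (obs p u y) 0; last first.
  apply: cvgM; first exact: cvg_within_filter co.
  (* [h] is continuous only relative to the simplex, so the posterior must converge within it. *)
  have cb : (fun q => bayes q u y) @ within D (nbhs p) -->
      within D (nbhs (bayes p u y)).
    move=> U /(bayes_filter_continuous zo).
    apply: (@filterS _ (nbhs p)) => q Uq Dq.
    exact: (Uq (bayes_filter_simplex u y Dq)).
  exact: cvg_comp cb (ch _ (bayes_filter_simplex u y Dp)).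
rewrite zo mul0r; apply/cvgrPdist_lt => e e0; rewrite near_withinE.
have K0 : 0 <= K by exact: le_trans (hK _ Dp).
(* [K] may be 0; adding 1 keeps the divisor positive. *)
have eK : 0 < e / (K + 1) by rewrite divr_gt0// ltr_wpDl.
have /cvgrPdist_lt /(_ _ eK) := co; rewrite zo.
apply: filterS => q; rewrite !sub0r !normrN => oq Dq.
rewrite normrM; apply: (@le_lt_trans _ _ (`|obs q u y| * (K + 1))).
  rewrite ler_wpM2l//; apply: le_trans (hK _ (bayes_filter_simplex u y Dq)) _.
  by rewrite lerDl.
by rewrite -ltr_pdivlMr// ltr_wpDl.
Qed.

Variables (gamma : R) (G : 'rV[R]_Nx -> 'I_Nu -> R).
Hypothesis hgamma : 0 < gamma < 1.
Hypothesis G_concave : forall u, concave_on D (fun p => G p u).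
Hypothesis G_continuous : forall u, continuous_on D (fun p => G p u).
Variable M : R.
Hypothesis M0 : 0 <= M.
Hypothesis G_bounded : forall p u, D p -> `|G p u| <= M.
Variable u0 : 'I_Nu.

Definition q_value h p u : R :=
  G p u + gamma * \sum_y obs p u y * h (bayes p u y).

Definition greedy h p : 'I_Nu := [arg min_(u < u0) q_value h p u]%O.

Definition bellman_op h p : R := q_value h p (greedy h p).

Lemma bellman_op_le h p u : bellman_op h p <= q_value h p u.
Proof. by rewrite /bellman_op /greedy; case: arg_minP => // v _; exact. Qed.

(** Each minimum is at most the value at the minimizer of the other. Equal beliefs give the
    contraction estimates, equal functions give continuity. *)
Lemma bellman_op_dist h k p q e :
  (forall u, `|q_value h p u - q_value k q u| <= e) ->
  `|bellman_op h p - bellman_op k q| <= e.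
Proof.
move=> H; have := bellman_op_le h p (greedy k q).
have := bellman_op_le k q (greedy h p).
have := H (greedy h p); have := H (greedy k q).
rewrite -!/(bellman_op _ _) !ler_norml => /andP[? ?] /andP[? ?] ? ?.
by apply/andP; split; lra.
Qed.

Lemma q_value_dist h k p u e : D p ->
  (forall q, D q -> `|h q - k q| <= e) ->
  `|q_value h p u - q_value k p u| <= gamma * e.
Proof.
move=> Dp H; have /andP[g0 _] := hgamma.
rewrite /q_value opprD addrACA subrr add0r -mulrBr normrM gtr0_norm//.
rewrite ler_wpM2l ?(ltW g0)// -sumrB.
rewrite -[leRHS]mul1r -(obs_pmf_sum hA1 hB1 u Dp) mulr_suml.
apply: le_trans (ler_norm_sum _ _ _) _; apply: ler_sum => y _.
rewrite -mulrBr normrM ger0_norm ?obs_pmf_ge0// ler_wpM2l ?obs_pmf_ge0//.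
by apply: H; exact: bayes_filter_simplex.
Qed.

Definition value_iter n : 'rV[R]_Nx -> R := iter n bellman_op (fun=> 0).

Lemma value_iter_step n p : D p ->
  `|value_iter n.+1 p - value_iter n p| <= gamma ^+ n * M.
Proof.
elim: n p => [|n IH] p Dp.
  rewrite /= subr0 expr0 mul1r /bellman_op /q_value big1 ?mulr0 ?addr0.
    exact: G_bounded.
  by move=> y _; rewrite mulr0.
rewrite exprS -mulrA; apply: bellman_op_dist => u.
exact: q_value_dist.
Qed.

(** The bound is the fixed point of [K -> gamma * K + M]: contraction against the image of 0, which
    is itself bounded by [M]. *)
Lemma value_iter_bounded n p : D p -> `|value_iter n p| <= M / (1 - gamma).
Proof.
have /andP[g0 g1] := hgamma.
have g1' : 0 < 1 - gamma by rewrite subr_gt0.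
elim: n p => [|n IH] p Dp; first by rewrite normr0 divr_ge0// ltW.
have h : `|value_iter n.+1 p - bellman_op (fun=> 0) p| <=
    gamma * (M / (1 - gamma)).
  apply: bellman_op_dist => u; apply: q_value_dist => // q Dq.
  by rewrite subr0; exact: IH.
have h1 := value_iter_step 0 Dp; rewrite expr0 mul1r subr0 in h1.
have -> : M / (1 - gamma) = gamma * (M / (1 - gamma)) + M.
  by field; rewrite gt_eqF.
rewrite -[X in `|X|](subrK (bellman_op (fun=> 0) p)).
exact: le_trans (ler_normD _ _) (lerD h h1).
Qed.

Lemma value_iter_concave n : concave_on D (value_iter n).
Proof.
elim: n => [|n IH]; first by move=> t p q _ _ _; rewrite !mulr0 addr0.
have /andP[g0 _] := hgamma => t p q t01 Dp Dq.
set r := t *: p + (1 - t) *: q.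
(* Fix the control optimal at the mixture: its concave [q_value] equals the minimum at [r] and
   dominates the minima at [p] and [q]. *)
have : concave_on D (q_value (value_iter n) ^~ (greedy (value_iter n) r)).
  apply: concave_onD => //; apply: concave_onZ; first exact: ltW.
  by apply: concave_on_sum => y; exact: obs_mul_comp_concave.
move=> /(_ t p q t01 Dp Dq); apply: le_trans.
case/andP: t01 => t0 t1.
by apply: lerD; rewrite ler_wpM2l ?subr_ge0//; exact: bellman_op_le.
Qed.

(** There are finitely many controls, so one neighbourhood serves the continuity of all the
    [q_value] functions. *)
Lemma value_iter_continuous n : continuous_on D (value_iter n).
Proof.
elim: n => [|n IH]; first by move=> p _; exact: cvg_cst.
apply/continuous_onP => p Dp e e0.
have e2 : 0 < e / 2 by rewrite divr_gt0.
have cQ u : \forall q \near p, D q ->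
    `|q_value (value_iter n) p u - q_value (value_iter n) q u| < e / 2.
  move: p Dp (e / 2) e2; apply/continuous_onP.
  apply: continuous_onD => //; apply: continuous_onZ.
  apply: continuous_on_sum => y; apply: obs_mul_comp_continuous IH.
  exact: value_iter_bounded.
have cQ' := @filter_forall _ _ _ (nbhs p) _ cQ.
near=> q => Dq.
have Hq : forall u, D q -> `|q_value (value_iter n) p u
    - q_value (value_iter n) q u| < e / 2 by near: q; exact: cQ'.
apply: (@le_lt_trans _ _ (e / 2)); last by lra.
by apply: bellman_op_dist => u; apply: ltW; exact: Hq.
Unshelve. all: by end_near.
Qed.

End bellman.

(** * Expected cost of a policy *)

Section finite_range.
Context d (T : measurableType d) (R : realType) (P : probability T R).
Context (V : choiceType) (X : T -> V) (s : seq V).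
Hypothesis us : uniq s.
Hypothesis Xs : forall w, X w \in s.
Hypothesis mX : forall v, v \in s -> measurable (X @^-1` [set v]).

(** Measurability is expressed by level sets alone, so beliefs are treated without a sigma-algebra
    on row vectors. *)
Lemma measurable_finite_range (S : set V) : measurable (X @^-1` S).
Proof.
have -> : X @^-1` S = \bigcup_(v in S `&` [set` s]) X @^-1` [set v].
  apply/seteqP; split => [w Sw|w [v [Sv _]] /= -> //].
  by exists (X w) => //; split => //=.
apply: fin_bigcup_measurable.
  exact: (sub_finite_set (@subIsetr _ _ _) (finite_seq s)).
by move=> v [_ /= vs]; exact: mX.
Qed.

Lemma finite_rangeE (g : V -> R) w :
  g (X w) = \sum_(v <- s) g v * \1_(X @^-1` [set v]) w.
Proof.
rewrite (bigD1_seq (X w))//= big1_seq ?addr0 => [|v /andP[vX _]].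
  by rewrite indicE mem_set//= mulr1.
by rewrite indicE memNset ?mulr0//= => Xv; rewrite Xv eqxx in vX.
Qed.

Lemma measurable_fun_finite_range (g : V -> R) :
  measurable_fun setT (fun w => g (X w)).
Proof.
by move=> _ U _; rewrite setTI; exact: (measurable_finite_range (g @^-1` U)).
Qed.

Lemma integral_finite_range (g : V -> R) :
  (\int[P]_w (g (X w))%:E =
   (\sum_(v <- s) g v * fine (P (X @^-1` [set v])))%:E)%E.
Proof.
have mXv v : measurable (X @^-1` [set v]) by exact: measurable_finite_range.
under eq_integral do rewrite finite_rangeE -sumEFin.
rewrite integral_sum//= => [|v].
  rewrite -sumEFin; apply: eq_bigr => v _.
  under eq_integral do rewrite EFinM.
  rewrite integralZl//=; last exact: integrable_indic.
  by rewrite integral_indic// setIT EFinM fineK// fin_num_measure.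
under [X in integrable _ _ X]funext do rewrite EFinM.
by apply: integrableZl => //; exact: integrable_indic.
Qed.

Lemma probability_finite_range (S : set V) :
  P (X @^-1` S) = (\sum_(v <- s) \1_S v * fine (P (X @^-1` [set v])))%:E.
Proof.
rewrite -integral_finite_range -[LHS](congr1 P (setIT _)).
by rewrite -integral_indic//; exact: measurable_finite_range.
Qed.

End finite_range.

(** * Transition operator of the belief and discounted cost of a policy *)

Section policy.
Variables (R : realType) (Nx Nu Ny : nat).
Variables (A : 'I_Nu -> 'M[R]_Nx) (B : 'I_Nu -> 'M[R]_(Nx, Ny)).
Hypothesis hA0 : forall u x xb, 0 <= A u x xb.
Hypothesis hA1 : forall u xb, \sum_x A u x xb = 1.
Hypothesis hB0 : forall u x y, 0 <= B u x y.
Hypothesis hB1 : forall u x, \sum_y B u x y = 1.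
Variable Pi0 : 'rV[R]_Nx -> 'I_Nu -> 'I_Ny -> 'rV[R]_Nx.
Local Notation D := (simplex R Nx).
Hypothesis hPi0 : forall p u y, D p -> D (Pi0 p u y).
Variable mu : 'rV[R]_Nx -> 'I_Nu.
Implicit Types (p q : 'rV[R]_Nx) (f h g : 'rV[R]_Nx -> R).
Local Notation obs := (obs_pmf A B).
Local Notation bayes := (bayes_filter A B Pi0).

(** Transition operator of the Markov chain of beliefs under [mu]. *)
Definition belief_kernel f q : R :=
  \sum_y obs q (mu q) y * f (bayes q (mu q) y).

Lemma belief_kernel_le f h q : D q -> (forall r, D r -> f r <= h r) ->
  belief_kernel f q <= belief_kernel h q.
Proof.
move=> Dq fh; apply: ler_sum => y _.
by rewrite ler_wpM2l ?obs_pmf_ge0//; apply/fh/bayes_filter_simplex.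
Qed.

Lemma belief_kernelD f h q :
  belief_kernel (fun r => f r + h r) q = belief_kernel f q + belief_kernel h q.
Proof. by rewrite -big_split/=; apply: eq_bigr => y _; rewrite mulrDr. Qed.

Lemma belief_kernelZ k f q :
  belief_kernel (fun r => k * f r) q = k * belief_kernel f q.
Proof.
by rewrite /belief_kernel mulr_sumr; apply: eq_bigr => y _; rewrite mulrCA.
Qed.

Lemma belief_kernel_cst k q : D q -> belief_kernel (fun=> k) q = k.
Proof. by move=> Dq; rewrite /belief_kernel -mulr_suml obs_pmf_sum// mul1r. Qed.

Lemma belief_kernel_sum (I : Type) (r : seq I) (F : I -> 'rV[R]_Nx -> R) q :
  belief_kernel (fun r' => \sum_(i <- r) F i r') q =
  \sum_(i <- r) belief_kernel (F i) q.
Proof.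
rewrite /belief_kernel exchange_big/=; apply: eq_bigr => y _.
by rewrite mulr_sumr.
Qed.

Lemma iter_belief_kernel_bounded n f K q : D q ->
  (forall r, D r -> `|f r| <= K) -> `|iter n belief_kernel f q| <= K.
Proof.
move=> + fK; elim: n q => [|n IH] q Dq; first exact: fK.
rewrite iterS ler_norml; apply/andP; split.
  rewrite -[leLHS](belief_kernel_cst _ Dq); apply: belief_kernel_le => // r Dr.
  by have := IH _ Dr; rewrite ler_norml => /andP[].
rewrite -[leRHS](belief_kernel_cst _ Dq); apply: belief_kernel_le => // r Dr.
by have := IH _ Dr; rewrite ler_norml => /andP[].
Qed.

Variables (gamma : R) (g : 'rV[R]_Nx -> R).
Hypothesis hgamma : 0 < gamma < 1.
Variable M : R.
Hypothesis M0 : 0 <= M.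
Hypothesis g_bounded : forall q, D q -> `|g q| <= M.

(** By [expectation_belief], [iter k belief_kernel g p] is the expected cost at time [k]. *)
Definition policy_cost_upto n p : R :=
  series (fun k => gamma ^+ k * iter k belief_kernel g p) n.

Definition policy_cost p : R := limn (policy_cost_upto ^~ p).

Lemma policy_cost_uptoS n p :
  policy_cost_upto n.+1 p = g p + gamma * belief_kernel (policy_cost_upto n) p.
Proof.
rewrite /policy_cost_upto /series/= big_nat_recl//= expr0 mul1r.
rewrite belief_kernel_sum mulr_sumr; congr +%R; apply: eq_bigr => k _.
by rewrite belief_kernelZ exprS mulrA.
Qed.

Lemma geometric_series_cvg (u : nat -> R) :
  (forall k, `|u k| <= gamma ^+ k * M) -> cvgn (series u).
Proof.
move=> uM; have /andP[g0 g1] := hgamma.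
apply: normed_cvg; apply: (@series_le_cvg _ _ (geometric M gamma)).
- by move=> k /=; exact: normr_ge0.
- by move=> k /=; rewrite mulr_ge0// exprn_ge0// ltW.
- by move=> k /=; rewrite mulrC.
- by apply: is_cvg_geometric_series; rewrite ger0_norm// ltW.
Qed.

Lemma geometric_series_le (u : nat -> R) n :
  (forall k, `|u k| <= gamma ^+ k * M) -> `|series u n| <= M / (1 - gamma).
Proof.
move=> uM; have /andP[g0 g1] := hgamma.
have g1' : 0 < 1 - gamma by rewrite subr_gt0.
apply: le_trans (ler_norm_sum _ _ _) _.
apply: (@le_trans _ _ (\sum_(0 <= k < n) gamma ^+ k * M)).
  by apply: ler_sum => k _; exact: uM.
rewrite -mulr_suml mulrC ler_wpM2l// -div1r ler_pdivlMr// mulrC.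
elim: n => [|n IH]; first by rewrite big_nil mulr0.
rewrite big_nat_recr//= mulrDr.
have -> : (1 - gamma) * \sum_(0 <= i < n) gamma ^+ i = 1 - gamma ^+ n.
  elim: n {IH} => [|n IH]; first by rewrite big_nil mulr0 expr0 subrr.
  by rewrite big_nat_recr//= mulrDr IH exprS; ring.
by rewrite mulrBl mul1r addrA subrK gerBl mulr_ge0// ?exprn_ge0// ltW.
Qed.

Lemma policy_cost_upto_cvg p : D p ->
  policy_cost_upto ^~ p @ \oo --> policy_cost p.
Proof.
move=> Dp; have /andP[g0 g1] := hgamma.
apply: geometric_series_cvg => k.
have gk : 0 <= gamma ^+ k by rewrite exprn_ge0// ltW.
rewrite normrM ger0_norm// ler_wpM2l//.
exact: iter_belief_kernel_bounded.
Qed.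

Section compare.
Variables (h : 'rV[R]_Nx -> R) (K e : R) (p : 'rV[R]_Nx).
Hypothesis hK : forall q, D q -> `|h q| <= K.
Hypothesis e0 : 0 <= e.
Hypothesis Dp : D p.

(** Total effect of an error [e] made at every step: the solution of [c = gamma * c + e]. *)
Let c := e / (1 - gamma).

Let g1' : 0 < 1 - gamma. Proof. by case/andP: hgamma; rewrite subr_gt0. Qed.

Let c0 : 0 <= c. Proof. by rewrite divr_ge0// ltW. Qed.

Let cE : gamma * c + e = c. Proof. by rewrite /c; field; rewrite gt_eqF. Qed.

Let error_cvg : (fun n => gamma ^+ n * K + c) @ \oo --> c.
Proof.
have /andP[g0 g1] := hgamma.
rewrite -[X in _ --> X]add0r; apply: cvgD; last exact: cvg_cst.
under [X in X @ _]funext do rewrite mulrC.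
by apply: cvg_geometric; rewrite ger0_norm// ltW.
Qed.

(** Unrolling the one-step inequality [n] times leaves the discounted value of [h] at the horizon,
    at most [gamma^n * K], which tends to 0. *)
Lemma le_policy_cost :
  (forall q, D q -> h q <= g q + gamma * belief_kernel h q + e) ->
  h p <= policy_cost p + c.
Proof.
move=> he; have /andP[g0 _] := hgamma.
have H n q : D q -> h q <= policy_cost_upto n q + (gamma ^+ n * K + c).
  elim: n q => [|n IH] q Dq.
    rewrite /policy_cost_upto /series/= big_nil add0r expr0 mul1r.
    by apply: ler_wpDr => //; apply: le_trans (hK Dq); exact: ler_norm.
  apply: le_trans (he _ Dq) _; rewrite policy_cost_uptoS.
  have := belief_kernel_le Dq IH.
  rewrite belief_kernelD belief_kernel_cst// -(ler_pM2l g0) exprS -!mulrA.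
  by rewrite !mulrDr; move: cE; lra.
have cv : (fun n => policy_cost_upto n p + (gamma ^+ n * K + c)) @ \oo -->
    policy_cost p + c.
  by apply: cvgD; [exact: policy_cost_upto_cvg|exact: error_cvg].
apply: (ler_cvg_to (@cvg_cst _ (h p) _ _ _) cv).
by near=> n; exact: H.
Unshelve. all: by end_near. Qed.

Lemma ge_policy_cost :
  (forall q, D q -> g q + gamma * belief_kernel h q <= h q + e) ->
  policy_cost p <= h p + c.
Proof.
move=> he; have /andP[g0 _] := hgamma.
have H n q : D q -> policy_cost_upto n q <= h q + (gamma ^+ n * K + c).
  elim: n q => [|n IH] q Dq.
    rewrite /policy_cost_upto /series/= big_nil expr0 mul1r addrA.
    apply: ler_wpDr => //; have := hK Dq.
    by rewrite ler_norml => /andP[]; lra.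
  have := he _ Dq; rewrite policy_cost_uptoS.
  have := belief_kernel_le Dq IH.
  rewrite belief_kernelD belief_kernel_cst// -(ler_pM2l g0) exprS -!mulrA.
  by rewrite !mulrDr; move: cE; lra.
have cv := policy_cost_upto_cvg Dp.
have cv' : (fun n => h p + (gamma ^+ n * K + c)) @ \oo --> h p + c.
  by apply: cvgD; [exact: cvg_cst|exact: error_cvg].
apply: (ler_cvg_to cv cv').
by near=> n; exact: H.
Unshelve. all: by end_near. Qed.

End compare.

End policy.

(** * Expectations along a given observation process *)

Section process.
Variables (R : realType) (Nx Nu Ny : nat).
Variables (A : 'I_Nu -> 'M[R]_Nx) (B : 'I_Nu -> 'M[R]_(Nx, Ny)).
Hypothesis hA0 : forall u x xb, 0 <= A u x xb.
Hypothesis hA1 : forall u xb, \sum_x A u x xb = 1.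
Hypothesis hB0 : forall u x y, 0 <= B u x y.
Hypothesis hB1 : forall u x, \sum_y B u x y = 1.
Variable Pi0 : 'rV[R]_Nx -> 'I_Nu -> 'I_Ny -> 'rV[R]_Nx.
Local Notation D := (simplex R Nx).
Hypothesis hPi0 : forall p u y, D p -> D (Pi0 p u y).
Variable mu : 'rV[R]_Nx -> 'I_Nu.
Local Notation obs := (obs_pmf A B).
Local Notation bayes := (bayes_filter A B Pi0).
Variables (p : 'rV[R]_Nx) (Dp : D p).
Context d (T : measurableType d) (P : probability T R) (Y : nat -> T -> 'I_Ny).
Hypothesis HY : observation_process A B Pi0 mu p P Y.
Local Notation bel := (belief A B Pi0 mu p Y).

Lemma belief_simplex k w : D (bel k w).
Proof. by elim: k => //= k IH; exact: bayes_filter_simplex. Qed.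

(** Distinct observation histories may lead to the same belief; [undup] makes each value count once
    in the finite sums. *)
Fixpoint belief_support k : seq 'rV[R]_Nx :=
  if k is k'.+1 then
    undup [seq bayes q (mu q) y | q <- belief_support k', y <- enum 'I_Ny]
  else [:: p].

Lemma belief_support_uniq k : uniq (belief_support k).
Proof. by case: k => //= k; exact: undup_uniq. Qed.

Lemma belief_supportP k w : bel k w \in belief_support k.
Proof.
elim: k => [|k IH] /=; first by rewrite inE.
rewrite mem_undup; apply/allpairsP; exists (bel k w, Y k.+1 w) => /=.
by rewrite mem_enum.
Qed.

Lemma belief_obs_uniq k :
  uniq [seq (q, y) | q <- belief_support k, y <- enum 'I_Ny].
Proof.
by apply: allpairs_uniq => [||[? ?] [? ?]]//;
  [exact: belief_support_uniq|exact: enum_uniq].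
Qed.

Lemma belief_obsP k w : (bel k w, Y k.+1 w) \in
  [seq (q, y) | q <- belief_support k, y <- enum 'I_Ny].
Proof.
apply/allpairsP; exists (bel k w, Y k.+1 w).
by rewrite belief_supportP mem_enum.
Qed.

Lemma belief_obs_preimage k q y :
  (fun w => (bel k w, Y k.+1 w)) @^-1` [set (q, y)] =
  (bel k @^-1` [set q]) `&` (Y k.+1 @^-1` [set y]).
Proof. by apply/seteqP; split => w /= => [[-> ->]|[-> ->]]. Qed.

(** The next belief is a function of the current belief and the next observation, a pair with
    finitely many values and measurable level sets. *)
Lemma measurable_belief k q : measurable (bel k @^-1` [set q]).
Proof.
elim: k q => [|k IH] q; first by rewrite preimage_cst; case: ifP.
apply: (@measurable_finite_range _ _ _ (fun w => (bel k w, Y k.+1 w))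
  [seq (r, y) | r <- belief_support k, y <- enum 'I_Ny] _ _
  [set ry | bayes ry.1 (mu ry.1) ry.2 = q]).
  exact: belief_obsP.
move=> [r y] _; rewrite belief_obs_preimage.
by apply: measurableI => //; case: HY.
Qed.

(** Both sides become finite sums, over next beliefs expressed through pairs (belief, observation)
    and over current beliefs; the conditional law gives the probability of each pair. *)
Lemma expectation_beliefS k (f : 'rV[R]_Nx -> R) :
  (\int[P]_w (f (bel k.+1 w))%:E =
   \int[P]_w (belief_kernel A B Pi0 mu f (bel k w))%:E)%E.
Proof.
rewrite (integral_finite_range P (belief_support_uniq k) (belief_supportP k));
  last by move=> *; exact: measurable_belief.
rewrite (@integral_finite_range _ _ _ P _ (fun w => (bel k w, Y k.+1 w))
  [seq (r, y) | r <- belief_support k, y <- enum 'I_Ny] (belief_obs_uniq k)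
  (belief_obsP k) _ (fun ry => f (bayes ry.1 (mu ry.1) ry.2))); last first.
  move=> [r y] _; rewrite belief_obs_preimage.
  by apply: measurableI; [exact: measurable_belief|case: HY].
congr EFin; rewrite big_allpairs_dep/=; apply: eq_bigr => q _.
rewrite /belief_kernel mulr_suml big_enum/=; apply: eq_bigr => y _.
rewrite belief_obs_preimage; have [_ /(_ k q (mu q) y) /=] := HY.
(* The control is a function of the belief, so for [u = mu q] the event is determined by the
   belief. *)
have -> : [set w | bel k w = q /\ control A B Pi0 mu p Y k w = mu q] =
    bel k @^-1` [set q].
  by apply/seteqP; split => w /= => [[]//|<-].
move=> ->; rewrite fineM// ?fin_num_measure//=; last exact: measurable_belief.
by ring.
Qed.

Lemma expectation_belief k (f : 'rV[R]_Nx -> R) :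
  (\int[P]_w (f (bel k w))%:E = (iter k (belief_kernel A B Pi0 mu) f p)%:E)%E.
Proof.
elim: k f => [|k IH] f.
  by rewrite /= integral_cst//= probability_setT mule1.
by rewrite expectation_beliefS IH iterSr.
Qed.

Variables (gamma : R) (G : 'rV[R]_Nx -> 'I_Nu -> R).
Hypothesis hgamma : 0 < gamma < 1.
Variable M : R.
Hypothesis M0 : 0 <= M.
Hypothesis G_bounded : forall q u, D q -> `|G q u| <= M.
Let g q := G q (mu q).

(** Dominated convergence: the partial sums are bounded by the constant [M / (1 - gamma)], and their
    expectations are computed term by term. *)
Lemma expectation_discounted_cost :
  ('E_P[discounted_cost A B Pi0 gamma G mu p Y] =
   (policy_cost A B Pi0 mu gamma g p)%:E)%E.
Proof.
have /andP[g0 g1] := hgamma.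
pose u w k := gamma ^+ k * g (bel k w).
have uM w k : `|u w k| <= gamma ^+ k * M.
  have gk : 0 <= gamma ^+ k by rewrite exprn_ge0// ltW.
  rewrite /u normrM ger0_norm// ler_wpM2l//.
  by apply: G_bounded; exact: belief_simplex.
have mu_ k : measurable_fun setT (fun w => u w k).
  apply: measurable_funM => //.
  apply: (@measurable_fun_finite_range _ _ _ _ (bel k) (belief_support k)).
    exact: belief_supportP.
  by move=> *; exact: measurable_belief.
have iu k : P.-integrable setT (EFin \o (fun w => u w k)).
  apply: measurable_bounded_integrable => //.
    by rewrite (le_lt_trans (probability_le1 P measurableT))// ltry.
  exists (gamma ^+ k * M); split; first exact: num_real.
  move=> r rM w _ /=.
  by apply: le_trans (ltW rM); exact: uM.
have mS n : measurable_fun setT (fun w => series (u w) n).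
  by apply: measurable_sum => k; exact: mu_.
have intS n : (\int[P]_w (series (u w) n)%:E =
    (policy_cost_upto A B Pi0 mu gamma g n p)%:E)%E.
  rewrite /series/=; under eq_integral do rewrite -sumEFin.
  rewrite integral_sum//= /policy_cost_upto /series/= -sumEFin.
  apply: eq_bigr => k _; under eq_integral do rewrite EFinM.
  rewrite integralZl//= ?expectation_belief//.
  apply: measurable_bounded_integrable => //.
  - by rewrite (le_lt_trans (probability_le1 P measurableT))// ltry.
  - apply: (@measurable_fun_finite_range _ _ _ _ (bel k) (belief_support k)).
      exact: belief_supportP.
    by move=> *; exact: measurable_belief.
  - exists M; split; first exact: num_real.
  move=> r rM w _ /=; apply: le_trans (ltW rM).
    by apply: G_bounded; exact: belief_simplex.
have cS w : series (u w) @ \oo --> limn (series (u w)).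
  exact: (geometric_series_cvg hgamma M0).
have mD : measurable_fun setT (discounted_cost A B Pi0 gamma G mu p Y).
  by apply: (measurable_fun_cvg mS) => w _; exact: cS.
have icst : P.-integrable setT (EFin \o (cst (M / (1 - gamma)) : T -> R)).
  exact: finite_measure_integrable_cst.
have [||||//|_ _ cvI] := @dominated_convergence _ _ _ P setT measurableT
  (fun n w => (series (u w) n)%:E)
  (fun w => (discounted_cost A B Pi0 gamma G mu p Y w)%:E)
  (EFin \o (cst (M / (1 - gamma)))).
- by move=> n; apply/measurable_EFinP.
- exact/measurable_EFinP.
- by apply: aeW => w _; apply: cvg_EFin; [near=> n|exact: cS].
- exact: icst.
- apply: aeW => w n _ /=; rewrite lee_fin.
  exact: (geometric_series_le hgamma M0).
rewrite unlock -(cvg_lim _ cvI)//; apply/cvg_lim => //.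
rewrite [X in X @ _](_ : _ = EFin \o
    (policy_cost_upto A B Pi0 mu gamma g ^~ p)); last first.
  by apply/funext => n /=; exact: intS.
apply: cvg_EFin; first by near=> n.
apply: (policy_cost_upto_cvg _ _ _ _ _ _ M0) => //.
by move=> q Dq; exact: G_bounded.
Unshelve. all: by end_near. Qed.

End process.

(** * Realization of the observation process by arithmetic coding *)

Section subdivision.
Variables (R : realType) (n : nat) (f : 'I_n -> R).
Hypothesis f0 : forall i, 0 <= f i.
Hypothesis f1 : \sum_i f i = 1.

(** Indexed by [nat], so that the right end [cumul n] of the last cell exists; [insub] turns indices
    below [n] into ordinals. *)
Definition cumul (k : nat) : R := \sum_(i < k) oapp f 0 (insub (i : nat)).

Lemma cumul0 : cumul 0 = 0.
Proof. by rewrite /cumul big_ord0. Qed.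

Lemma cumulS (i : 'I_n) : cumul i.+1 = cumul i + f i.
Proof. by rewrite /cumul big_ord_recr/= valK. Qed.

Lemma cumul_total : cumul n = 1.
Proof. by rewrite -f1; apply: eq_bigr => i _; rewrite valK. Qed.

Lemma cumul_mono i j : (i <= j)%N -> cumul i <= cumul j.
Proof.
move=> /subnKC <-; elim: (j - i)%N => [|k IH]; first by rewrite addn0.
rewrite addnS; apply: le_trans IH _; rewrite /cumul big_ord_recr/= lerDl.
by case: insub => //= y; exact: f0.
Qed.

(** Half-open cells partition [[a, a + l[]; a cell of weight zero is empty. *)
Definition subcell (a l : R) (i : 'I_n) (w : R) : bool :=
  a + l * cumul i <= w < a + l * cumul i + l * f i.

Lemma subcell_sub a l i w : 0 <= l -> subcell a l i w -> a <= w < a + l.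
Proof.
move=> l0 /andP[w0 w1].
have := cumul_mono (leq0n i); rewrite cumul0 => c0.
have := cumul_mono (ltn_ord i); rewrite cumul_total cumulS => c1.
have h0 : 0 <= l * cumul i by rewrite mulr_ge0.
have h1 : l * (cumul i + f i) <= l * 1 by rewrite ler_wpM2l.
by rewrite mulrDr mulr1 in h1; apply/andP; split; lra.
Qed.

Lemma subcell_uniq a l i j w : 0 <= l ->
  subcell a l i w -> subcell a l j w -> i = j.
Proof.
move=> l0; wlog ij : i j / (i <= j)%N => [H|].
  have [ij|/ltnW ji] := leqP i j; first exact: H.
  by move=> ? ?; apply/esym/H.
move=> /andP[_ w1] /andP[w0 _].
have [ij'|ij'] := ltnP i j; last by apply/val_inj/anti_leq; rewrite ij.
have h := ler_wpM2l l0 (cumul_mono ij'); rewrite cumulS mulrDr in h.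
by exfalso; lra.
Qed.

Lemma subcell_exists a l w : a <= w < a + l -> exists i, subcell a l i w.
Proof.
move=> /andP[w0 w1].
have ex : exists k, w < a + l * cumul k.
  by exists n; rewrite cumul_total mulr1.
(* The least index whose endpoint exceeds [w] is positive, and its predecessor is the cell of
   [w]. *)
case: (ex_minnP ex) => -[|k]; first by rewrite cumul0 mulr0 addr0 ltNge w0.
move=> wk kmin; have kn : (k < n)%N.
  by apply: kmin; rewrite cumul_total mulr1.
exists (Ordinal kn); apply/andP; split.
  by rewrite leNgt; apply/negP => /kmin; rewrite ltnn.
by rewrite -addrA -mulrDr -(cumulS (Ordinal kn)).
Qed.

Definition locate (i0 : 'I_n) (a l w : R) : 'I_n :=
  odflt i0 [pick i | subcell a l i w].

Lemma locateP i0 a l w i : 0 <= l -> a <= w < a + l ->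
  (locate i0 a l w = i) <-> subcell a l i w.
Proof.
move=> l0 /subcell_exists[j jw]; rewrite /locate.
case: pickP => [k kw|/(_ j)]; last by rewrite jw.
by split=> [<- //|iw /=]; exact: subcell_uniq kw iw.
Qed.

End subdivision.

(** * The uniform law on the unit interval *)

Section uniform_interval.
Variable R : realType.
Local Notation P := (uniform_prob (@ltr01 R)).

(** The sample space is the whole line; sending the null set outside [[0, 1[] to 0 lets every sample
    point be decoded. *)
Definition clamp01 (w : R) : R := if 0 <= w < 1 then w else 0.

Lemma clamp01_itv w : 0 <= clamp01 w < 1.
Proof. by rewrite /clamp01; case: ifP => // _; rewrite lexx ltr01. Qed.

Lemma preimage_clamp01 (a b : R) : 0 <= a -> b <= 1 ->
  [set w | a <= clamp01 w < b] =
  `[a, b[%classic `|`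
  (* Points outside [[0, 1[] are included exactly when [[a, b[] contains 0, their clamped value. *)
  (if a <= 0 < b then ~` `[0, 1[%classic else set0).
Proof.
move=> a0 b1; apply/seteqP; split => w /=; rewrite /clamp01 in_itv/=.
  case: ifPn => [w01 ->|w01 ->]; first by left.
  by right; rewrite /= in_itv/=; exact/negP.
case=> [/andP[aw wb]|].
  by rewrite (le_trans a0 aw) (lt_le_trans wb b1)/= aw wb.
by case: ifPn => [ab|_ //]; rewrite /= in_itv/= => /negP/negPf ->.
Qed.

Lemma measurable_preimage_clamp01 (a b : R) : 0 <= a -> b <= 1 ->
  measurable [set w | a <= clamp01 w < b].
Proof.
move=> a0 b1; rewrite preimage_clamp01//; apply: measurableU => //.
by case: ifP => // _; exact: measurableC.
Qed.

Lemma uniform_prob_itv (a b : R) : 0 <= a -> a <= b -> b <= 1 ->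
  P `[a, b[%classic = (b - a)%:E.
Proof.
move=> a0 ab b1; rewrite /uniform_prob.
rewrite (eq_integral (fun=> 1%:E)); last first.
  move=> x; rewrite inE/= in_itv/= => /andP[ax xb]; rewrite /uniform_pdf.
  by rewrite (le_trans a0 ax) (le_trans (ltW xb) b1) subr0 invr1.
rewrite integral_cst//= mul1e lebesgue_measure_itv/= lte_fin.
case: ltP => [//|ba]; have -> : a = b by lra.
by rewrite subrr.
Qed.

Lemma uniform_prob_clamp01 (a b : R) : 0 <= a -> a <= b -> b <= 1 ->
  P [set w | a <= clamp01 w < b] = (b - a)%:E.
Proof.
move=> a0 ab b1; rewrite preimage_clamp01//.
have P0 : P (~` `[0, 1[%classic) = 0%E.
  rewrite probability_setC//; apply/eqP; rewrite sube_eq// ?add0e.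
    by apply/eqP/esym; rewrite [LHS]uniform_prob_itv// subr0.
rewrite measureU//; last 2 first.
- by case: ifP => // _; exact: measurableC.
- case: ifP => _; last by rewrite setI0.
  apply/seteqP; split => w //= []; rewrite !in_itv/= => /andP[aw wb] []//.
  by rewrite (le_trans a0 aw) (lt_le_trans wb b1).
transitivity ((b - a)%:E + 0)%E; last by rewrite adde0.
by congr adde; [exact: uniform_prob_itv|case: ifP].
Qed.

End uniform_interval.

(** * Decoding a uniform point into observations *)

Section coding.
Variables (R : realType) (Nx Nu Ny : nat).
Variables (A : 'I_Nu -> 'M[R]_Nx) (B : 'I_Nu -> 'M[R]_(Nx, Ny)).
Hypothesis hA0 : forall u x xb, 0 <= A u x xb.
Hypothesis hA1 : forall u xb, \sum_x A u x xb = 1.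
Hypothesis hB0 : forall u x y, 0 <= B u x y.
Hypothesis hB1 : forall u x, \sum_y B u x y = 1.
Variable Pi0 : 'rV[R]_Nx -> 'I_Nu -> 'I_Ny -> 'rV[R]_Nx.
Local Notation D := (simplex R Nx).
Hypothesis hPi0 : forall p u y, D p -> D (Pi0 p u y).
Variable mu : 'rV[R]_Nx -> 'I_Nu.
Local Notation obs := (obs_pmf A B).
Local Notation bayes := (bayes_filter A B Pi0).
Variables (p : 'rV[R]_Nx) (Dp : D p) (y0 : 'I_Ny).
Local Notation state := ('rV[R]_Nx * (R * R))%type.
Local Notation P := (uniform_prob (@ltr01 R)).
Implicit Types (s : state) (k : nat) (w : R) (y : 'I_Ny) (q : 'rV[R]_Nx).

Let f q y := obs q (mu q) y.
Let f_ge0 q y : D q -> 0 <= f q y. Proof. exact: obs_pmf_ge0. Qed.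
Let f_sum q : D q -> \sum_y f q y = 1. Proof. exact: obs_pmf_sum. Qed.

(* A state [(q, (a, l))] is a belief together with the interval [[a, a + l[] of
   the sample points that produce the observations leading to it; a further
   observation [y] selects a subinterval of length [l * f q y]. *)
Definition coding_step s y : state :=
  (bayes s.1 (mu s.1) y,
   (s.2.1 + s.2.2 * cumul (f s.1) y, s.2.2 * f s.1 y)).

Definition coding_obs s w : 'I_Ny := locate (f s.1) y0 s.2.1 s.2.2 (clamp01 w).

Fixpoint coding_state k w : state :=
  if k is k'.+1 then
    let s := coding_state k' w in coding_step s (coding_obs s w)
  else (p, (0, 1)).

(** Observation [k] is decoded from the state reached after [k - 1] observations, matching [belief],
    which starts reading at index 1. *)
Definition coded_obs k w : 'I_Ny := coding_obs (coding_state k.-1 w) w.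

Lemma belief_coded_obs k w :
  belief A B Pi0 mu p coded_obs k w = (coding_state k w).1.
Proof. by elim: k => //= k ->. Qed.

Fixpoint coding_support k : seq state :=
  if k is k'.+1 then
    undup [seq coding_step s y | s <- coding_support k', y <- enum 'I_Ny]
  else [:: (p, (0, 1))].

Lemma coding_support_uniq k : uniq (coding_support k).
Proof. by case: k => //= k; exact: undup_uniq. Qed.

Lemma coding_stateP k w : coding_state k w \in coding_support k.
Proof.
elim: k => [|k IH] /=; first by rewrite inE.
rewrite mem_undup; apply/allpairsP.
exists (coding_state k w, coding_obs (coding_state k w) w) => /=.
by rewrite mem_enum.
Qed.

Lemma coding_support_bounds k s : s \in coding_support k ->
  [/\ D s.1, 0 <= s.2.1, 0 <= s.2.2 & s.2.1 + s.2.2 <= 1].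
Proof.
elim: k s => [|k IH] s /=.
  by rewrite inE => /eqP -> /=; rewrite add0r lexx ler01; split.
rewrite mem_undup => /allpairsP[[r y] /= [/IH[Dr a0 l0 al] _ ->]] /=.
have fr0 := fun i => f_ge0 i Dr; have fr1 := f_sum Dr.
have c0 := cumul_mono fr0 (leq0n y); rewrite cumul0 in c0.
have c1 := cumul_mono fr0 (ltn_ord y); rewrite cumul_total// cumulS in c1.
split.
- exact: bayes_filter_simplex.
- by rewrite addr_ge0// mulr_ge0.
- by rewrite mulr_ge0.
- rewrite -addrA -mulrDr; apply: le_trans al; rewrite lerD2l.
  by rewrite -[leRHS]mulr1 ler_wpM2l.
Qed.

Definition in_coding_itv s w : bool := s.2.1 <= clamp01 w < s.2.1 + s.2.2.

Lemma coding_obsP k s w y : s \in coding_support k -> in_coding_itv s w ->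
  coding_obs s w = y <-> in_coding_itv (coding_step s y) w.
Proof.
move=> /coding_support_bounds[Dr a0 l0 al] sw.
by apply: locateP => //; [move=> i; exact: f_ge0|exact: f_sum].
Qed.

Lemma coding_step_sub k s w y : s \in coding_support k ->
  in_coding_itv (coding_step s y) w -> in_coding_itv s w.
Proof.
move=> /coding_support_bounds[Dr a0 l0 al].
by apply: subcell_sub => //; [move=> i; exact: f_ge0|exact: f_sum].
Qed.

Lemma coding_state_itv k w : in_coding_itv (coding_state k w) w.
Proof.
elim: k => [|k IH]; first by rewrite /in_coding_itv/= add0r clamp01_itv.
by apply/(coding_obsP _ (coding_stateP k w) IH).
Qed.

(** Since a state records its interval, its event is that interval, whereas a belief may be reached
    through several. By nesting, [w] lies in the parent interval, which fixes the earlier states. *)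
Lemma coding_state_eq k s w : s \in coding_support k ->
  coding_state k w = s <-> in_coding_itv s w.
Proof.
move=> sk; split=> [<-|]; first exact: coding_state_itv.
elim: k s sk => [|k IH] s /=; first by rewrite inE => /eqP ->.
rewrite mem_undup => /allpairsP[[r y] /= [rk _ ->]] ryw.
have rw_ := coding_step_sub rk ryw.
by rewrite (IH _ rk rw_); congr coding_step; apply/(coding_obsP _ rk rw_).
Qed.

Lemma coding_state_preimage k s : s \in coding_support k ->
  coding_state k @^-1` [set s] = [set w | in_coding_itv s w].
Proof. by move=> sk; apply/seteqP; split => w /= /(coding_state_eq _ sk). Qed.

Lemma coding_state_obs_preimage k s y : s \in coding_support k ->
  (fun w => (coding_state k w, coded_obs k.+1 w)) @^-1` [set (s, y)] =
  [set w | in_coding_itv (coding_step s y) w].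
Proof.
move=> sk; apply/seteqP; split => w /=.
  move=> [sE]; rewrite /coded_obs/= sE.
  by move/(coding_obsP _ sk) => -> //; apply/(coding_state_eq _ sk).
move=> syw; have sw := coding_step_sub sk syw.
have sE := (coding_state_eq w sk).2 sw.
by rewrite /coded_obs/= sE; congr pair; apply/(coding_obsP _ sk sw).
Qed.

Lemma uniform_prob_coding_itv k s : s \in coding_support k ->
  P [set w | in_coding_itv s w] = (s.2.2)%:E.
Proof.
move=> /coding_support_bounds[Dr a0 l0 al].
by rewrite uniform_prob_clamp01 ?lerDl//; congr EFin; ring.
Qed.

Lemma measurable_coding_itv k s : s \in coding_support k ->
  measurable [set w | in_coding_itv s w].
Proof.
move=> /coding_support_bounds[Dr a0 l0 al].
exact: measurable_preimage_clamp01.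
Qed.

Lemma coding_step_support k s y : s \in coding_support k ->
  coding_step s y \in coding_support k.+1.
Proof.
move=> sk /=; rewrite mem_undup; apply/allpairsP; exists (s, y).
by rewrite mem_enum.
Qed.

Let pairs k := [seq (s, y) | s <- coding_support k, y <- enum 'I_Ny].

Let pairs_uniq k : uniq (pairs k).
Proof.
by apply: allpairs_uniq => [||[? ?] [? ?]]//;
  [exact: coding_support_uniq|exact: enum_uniq].
Qed.

Let pairsP k w : (coding_state k w, coded_obs k.+1 w) \in pairs k.
Proof.
apply/allpairsP; exists (coding_state k w, coded_obs k.+1 w).
by rewrite coding_stateP mem_enum.
Qed.

Let measurable_pairs k sy : sy \in pairs k ->
  measurable ((fun w => (coding_state k w, coded_obs k.+1 w)) @^-1` [set sy]).
Proof.
move=> /allpairsP[[s y] /= [sk _ ->]]; rewrite coding_state_obs_preimage//.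
exact: (measurable_coding_itv (coding_step_support y sk)).
Qed.

(** The event that the belief is [q] is a finite disjoint union of intervals, in each of which [y]
    selects the fraction [obs q (mu q) y]. *)
Lemma coded_obs_process : observation_process A B Pi0 mu p P coded_obs.
Proof.
split=> [k y|k q u y /=].
  exact: (measurable_finite_range (@pairsP k) (@measurable_pairs k)
    [set sy | sy.2 = y]).
have bE w : belief A B Pi0 mu p coded_obs k w = (coding_state k w).1.
  exact: belief_coded_obs.
(* A control other than [mu q] makes the conditioning event empty, and both sides are 0. *)
have [uq|uq] := eqVneq u (mu q); last first.
  rewrite (_ : mkset _ = set0) ?set0I ?measure0 ?mul0e//.
  by apply/seteqP; split => // w /= [+ cu]; move: cu;
    rewrite /control => + qE; rewrite qE => uE; rewrite uE eqxx in uq.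
have -> : [set w | belief A B Pi0 mu p coded_obs k w = q /\
    control A B Pi0 mu p coded_obs k w = u] =
    coding_state k @^-1` [set s | s.1 = q].
  apply/seteqP; split => w /=; rewrite /control bE; first by case.
  by move=> ->.
have -> : coding_state k @^-1` [set s | s.1 = q] `&`
    coded_obs k.+1 @^-1` [set y] =
    (fun w => (coding_state k w, coded_obs k.+1 w)) @^-1`
        [set sy | sy.1.1 = q /\ sy.2 = y] by [].
rewrite (probability_finite_range P (@pairs_uniq k) (@pairsP k)
  (@measurable_pairs k)).
rewrite (probability_finite_range P (coding_support_uniq k) (coding_stateP k));
  last first.
  move=> s sk; rewrite coding_state_preimage//.
  exact: (measurable_coding_itv sk).
rewrite -EFinM; congr EFin; rewrite big_allpairs_dep/= mulr_suml.
rewrite big_seq [RHS]big_seq; apply: eq_bigr => s sk.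
rewrite big_enum/= (bigD1 y)//= big1 ?addr0 => [|z zy]; last first.
  by rewrite indicE memNset ?mul0r//= => -[_ /eqP]; rewrite (negPf zy).
rewrite coding_state_obs_preimage// coding_state_preimage//.
rewrite (uniform_prob_coding_itv sk).
rewrite (uniform_prob_coding_itv (coding_step_support y sk))/= !indicE.
have [sq|sq] := pselect (s.1 = q); last first.
  by rewrite memNset ?mul0r ?memNset ?mul0r//= => -[].
by rewrite !mem_set//= !mul1r /f sq uq.
Qed.

End coding.

(** * The optimal value *)

Section optimal.
Variables (R : realType) (Nx Nu Ny : nat).
Variables (A : 'I_Nu -> 'M[R]_Nx) (B : 'I_Nu -> 'M[R]_(Nx, Ny)).
Hypothesis hA0 : forall u x xb, 0 <= A u x xb.
Hypothesis hA1 : forall u xb, \sum_x A u x xb = 1.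
Hypothesis hB0 : forall u x y, 0 <= B u x y.
Hypothesis hB1 : forall u x, \sum_y B u x y = 1.
Variable Pi0 : 'rV[R]_Nx -> 'I_Nu -> 'I_Ny -> 'rV[R]_Nx.
Local Notation D := (simplex R Nx).
Hypothesis hPi0 : forall p u y, D p -> D (Pi0 p u y).
Variables (gamma : R) (G : 'rV[R]_Nx -> 'I_Nu -> R).
Hypothesis hgamma : 0 < gamma < 1.
Variable M : R.
Hypothesis M0 : 0 <= M.
Hypothesis G_bounded : forall p u, D p -> `|G p u| <= M.
Variables (u0 : 'I_Nu) (y0 : 'I_Ny).
Local Notation iter_V := (value_iter A B Pi0 gamma G u0).
Local Notation V := (optimal_value A B Pi0 gamma G).

(** Successive iterates differ by at most [gamma^n * M], so [V_n] solves Bellman's equation up to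
    that error, which accumulates to the stated bound. *)
Lemma optimal_value_dist n p : D p ->
  `|V p - iter_V n p| <= gamma ^+ n * M / (1 - gamma).
Proof.
move=> Dp; have /andP[g0 g1] := hgamma.
set h := iter_V n; set c := gamma ^+ n * M / (1 - gamma).
have e0 : 0 <= gamma ^+ n * M by rewrite mulr_ge0// exprn_ge0// ltW.
have hK q : D q -> `|h q| <= M / (1 - gamma).
  by move=> Dq; apply: value_iter_bounded.
have step q : D q -> `|iter_V n.+1 q - h q| <= gamma ^+ n * M.
  by move=> Dq; apply: value_iter_step.
(* The Bellman image of [h] is at most the [q_value] of the control chosen by any policy. *)
have lower mu : h p - c <= policy_cost A B Pi0 mu gamma (fun q => G q (mu q)) p.
  rewrite lerBlDr.
  apply: (le_policy_cost hA0 hA1 hB0 hB1 hPi0 hgamma M0) hK _ _ _ => //.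
    by move=> q Dq; exact: G_bounded.
  move=> q Dq; have := step _ Dq; rewrite ler_norml => /andP[+ _].
  have := bellman_op_le A B Pi0 gamma G u0 h q (mu q).
  by rewrite /q_value /belief_kernel /= -/h; lra.
pose mu := greedy A B Pi0 gamma G u0 h.
(* The greedy policy attains the Bellman image of [h]. *)
have upper : policy_cost A B Pi0 mu gamma (fun q => G q (mu q)) p <= h p + c.
  apply: (ge_policy_cost hA0 hA1 hB0 hB1 hPi0 hgamma M0) hK _ _ _ => //.
    by move=> q Dq; exact: G_bounded.
  move=> q Dq; have := step _ Dq; rewrite ler_norml => /andP[_].
  by rewrite /= -/h /bellman_op /q_value /belief_kernel -/mu; lra.
rewrite /optimal_value; set S := [set v | _].
have inf_le : (ereal_inf S <= (h p + c)%:E)%E.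
  apply: (@le_trans _ _
    (policy_cost A B Pi0 mu gamma (fun q => G q (mu q)) p)%:E);
    last by rewrite lee_fin.
  (* The coded process is the realization that puts the cost of the greedy policy in [S]. *)
  apply: ereal_inf_lbound; exists mu, _, _, (uniform_prob (@ltr01 R)).
  have HY := coded_obs_process hA0 hA1 hB0 hB1 hPi0 mu Dp y0.
  exists (coded_obs A B Pi0 mu p y0); split => //.
  by rewrite (expectation_discounted_cost hA0 hA1 hB0 hB1 hPi0 Dp HY hgamma M0).
have inf_ge : ((h p - c)%:E <= ereal_inf S)%E.
  apply: le_ereal_inf_tmp => _ [nu [d [T [P [Y [HY ->]]]]]].
  by rewrite (expectation_discounted_cost hA0 hA1 hB0 hB1 hPi0 Dp HY hgamma M0)//
    lee_fin.
(* The two real bounds exclude infinite values, so [fine] returns the infimum itself. *)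
case: (ereal_inf S) inf_le inf_ge => [v| |]//=; rewrite !lee_fin => v1 v0.
by rewrite ler_norml; apply/andP; split; lra.
Qed.

Lemma optimal_value_approx e : 0 < e ->
  exists n, forall p, D p -> `|V p - iter_V n p| <= e.
Proof.
move=> e0; have /andP[g0 g1] := hgamma.
have g1' : 0 < 1 - gamma by rewrite subr_gt0.
have ec : 0 < e * (1 - gamma) by rewrite mulr_gt0.
have : geometric M gamma @ \oo --> 0.
  by apply: cvg_geometric; rewrite ger0_norm// ltW.
move=> /cvgrPdist_lt/(_ _ ec)[n _ /(_ n (leqnn n))] /=.
rewrite sub0r normrN => hn; exists n => p Dp.
apply: le_trans (optimal_value_dist n Dp) _.
by rewrite ler_pdivrMr// mulrC ltW// (le_lt_trans _ hn)// ler_norm.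
Qed.

Hypothesis G_concave : forall u, concave_on D (fun p => G p u).
Hypothesis G_continuous : forall u, continuous_on D (fun p => G p u).

Lemma optimal_value_concave : concave_on D V.
Proof.
apply: uniform_limit_concave_on => [|e e0]; first exact: simplex_conv.
have [n Hn] := optimal_value_approx e0.
by exists (iter_V n) => //; exact: value_iter_concave.
Qed.

Lemma optimal_value_continuous : continuous_on D V.
Proof.
apply: uniform_limit_continuous_on => e e0.
have [n Hn] := optimal_value_approx e0.
exists (iter_V n) => //.
exact: (value_iter_continuous hA0 hA1 hB0 hB1 hPi0 hgamma G_continuous M0).
Qed.

End optimal.

Theorem mainTheorem3 (R : realType) (Nx Nu Ny : nat)
    (hNx : (0 < Nx)%N) (hNu : (0 < Nu)%N) (hNy : (0 < Ny)%N)
    (A : 'I_Nu -> 'M[R]_Nx) (B : 'I_Nu -> 'M[R]_(Nx, Ny))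
    (hA0 : forall u x xb, 0 <= A u x xb)
    (hA1 : forall u xb, \sum_x A u x xb = 1)
    (hB0 : forall u x y, 0 <= B u x y)
    (hB1 : forall u x, \sum_y B u x y = 1)
    (c : 'I_Nx -> 'I_Nu -> R) (cT : 'I_Nx -> R)
    (Pi0 : 'rV[R]_Nx -> 'I_Nu -> 'I_Ny -> 'rV[R]_Nx)
    (hPi0 : forall p u y, simplex R Nx p -> simplex R Nx (Pi0 p u y))
    (gamma beta lambda : R)
    (hgamma : 0 < gamma < 1) (hbeta : 0 <= beta) (hlambda : 0 <= lambda) :
  let G := belief_cost A B c cT gamma beta lambda in
  let V := optimal_value A B Pi0 gamma G in
  (forall u, concave_function (simplex R Nx) (fun p => G p u) /\
             {within simplex R Nx, continuous (fun p => G p u)}) /\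
  (concave_function (simplex R Nx) V /\
   {within simplex R Nx, continuous V}).
Proof.
move=> G V.
have Gconc u : concave_on (simplex R Nx) (fun p => G p u).
  exact: belief_cost_concave.
have Gcont u : continuous_on (simplex R Nx) (fun p => G p u).
  exact: belief_cost_continuous_on.
have [M M0 GM] := belief_cost_bounded B hA0 c cT gamma beta lambda.
(* Default elements for the minimization over controls and for the decoder. *)
pose u0 := Ordinal hNu; pose y0 := Ordinal hNy.
split=> [u|]; split.
- exact: concave_onW.
- exact/continuous_on_within.
- apply: concave_onW.
  exact: (optimal_value_concave hA0 hA1 hB0 hB1 hPi0 hgamma M0 GM u0 y0).
- apply/continuous_on_within.
  exact: (optimal_value_continuous hA0 hA1 hB0 hB1 hPi0 hgamma M0 GM u0 y0).
Qed.
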